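(* Let $f\in L^1(\Omega)$. Then $T_Zf\in L^q(\Omega)$ for any $1\le q<2-\dfrac{\sigma}{\sigma+1}$.
   Context: Setting. $C^{1+\epsilon}$ denotes $C^1$ with first derivatives Hölder continuous of exponent $\epsilon$, for some $\epsilon>0$. $\tilde\Omega\subset\mathbb{R}^2$ is open, $L=A(x,y)\partial/\partial x+B(x,y)\partial/\partial y$ is a complex vector field on $\tilde\Omega$ with $\mathbb{C}$-valued Hölder continuous coefficients, $|A|+|B|>0$, and $\Omega$ is a relatively compact open set, $\overline\Omega\subset\tilde\Omega$, with $\partial\Omega$ piecewise of class $C^1$. The characteristic set is $\Sigma=\{\mathsf p\in\overline\Omega:\ \Im(A\overline B)(\mathsf p)=0\}$. It is assumed that: (i) $L$ is hypocomplex in $\overline\Omega$: for every $\mathsf p\in\overline\Omega$ there are an open set $\mathcal U\ni\mathsf p$ and a $C^{1+\epsilon}$ function $Z:\mathcal U\to\mathbb{C}$ (a first integral) with $dZ\neq0$, $LZ=0$, and $Z:\mathcal U\to Z(\mathcal U)$ a homeomorphism; (ii) $\Sigma$ is a $C^{1+\epsilon}$ curve nontangent to $L$ (i.e. $L_{\mathsf p}\notin\mathbb{C}\otimes T_{\mathsf p}\Sigma$ for $\mathsf p\in\Sigma$); (iii) for every $\mathsf p\in\Sigma$ there is an open set $\mathcal U\ni\mathsf p$ in which $\Sigma\cap\mathcal U$ is given by a $C^{1+\epsilon}$ defining function $\rho$ and $\Im(A\overline B)(x,y)=|\rho(x,y)|^{\sigma_{\mathsf p}}g(x,y)$ for some $\sigma_{\mathsf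 p}>0$ and some continuous $g$ nowhere zero in $\mathcal U$. $\Sigma$ has finitely many connected components $\Sigma_1,\dots,\Sigma_N$; the exponent in (iii) equals a constant $\sigma_j>0$ along $\Sigma_j$, and $\sigma=\max_j\sigma_j$. $Z:\overline\Omega\to Z(\overline\Omega)\subset\mathbb{C}$ is a fixed global first integral of $L$: it is of class $C^{1+\epsilon}$, a homeomorphism onto its image, with $LZ=0$ and $dZ\neq0$. It is assumed that $L=Z_x\,\partial/\partial y-Z_y\,\partial/\partial x$. For $f\in L^1(\Omega)$, $$T_Zf(x,y)=\frac1{2\pi i}\int_\Omega\frac{f(\xi,\eta)}{Z(\xi,\eta)-Z(x,y)}\,d\xi d\eta .$$ *)

(* Defs.v *)
From HB Require Import structures.
From mathcomp Require Import all_boot all_order all_algebra.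
From mathcomp Require Import complex.
From mathcomp Require Import all_classical all_reals all_analysis.

Set Implicit Arguments.
Unset Strict Implicit.
Unset Printing Implicit Defensive.

Import Order.TTheory GRing.Theory Num.Theory.
Import numFieldNormedType.Exports.

Local Open Scope classical_set_scope.
Local Open Scope ring_scope.
Local Open Scope complex_scope.

Local Notation Re := (@complex.Re _).
Local Notation Im := (@complex.Im _).

Section Regularity.
Context {R : realType}.
Implicit Types (U K : set (R * R)) (f : R * R -> R) (Z : R * R -> R[i]).

Definition e1 : R * R := (1, 0).
Definition e2 : R * R := (0, 1).

(* On an open set, Hoelder regularity is understood locally, with one exponent;
   for [eps > 1] this implies the condition with any smaller exponent. *)
Definition loc_holder (eps : R) U f : Prop :=
  forall p, U p -> exists2 V : set (R * R), open V /\ V p &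
    exists C : R, forall q q', (U `&` V) q -> (U `&` V) q' ->
      `|f q - f q'| <= C * `|q - q'| `^ eps.

Definition holder_cplx U Z : Prop :=
  exists2 eps : R, 0 < eps &
    loc_holder eps U (fun p => Re (Z p)) /\ loc_holder eps U (fun p => Im (Z p)).

Definition C1_holder (eps : R) U f : Prop :=
  [/\ forall p, U p -> derivable f p e1 /\ derivable f p e2,
      loc_holder eps U ('D_e1 f) & loc_holder eps U ('D_e2 f)].

Definition C1eps U f : Prop := exists2 eps : R, 0 < eps & C1_holder eps U f.

Definition C1eps_cplx U Z : Prop :=
  exists2 eps : R, 0 < eps &
    C1_holder eps U (fun p => Re (Z p)) /\ C1_holder eps U (fun p => Im (Z p)).

(* Class C^{1+eps} up to the boundary of the compact set [K]: [Z] is of class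
   C^{1+eps} on an open neighbourhood of [K], so that its first derivatives
   make sense at the points of the boundary of [K]. *)
Definition C1eps_cplx_closed K Z : Prop :=
  exists V : set (R * R), [/\ open V, K `<=` V & C1eps_cplx V Z].

Definition pderiv (v : R * R) Z (p : R * R) : R[i] :=
  'D_v (fun q => Re (Z q)) p +i* 'D_v (fun q => Im (Z q)) p.

Definition dZ_neq0 Z (p : R * R) : Prop :=
  ~ (pderiv e1 Z p = 0 /\ pderiv e2 Z p = 0).

(* L Z for L = A d/dx + B d/dy. *)
Definition vf_apply (A B Z : R * R -> R[i]) (p : R * R) : R[i] :=
  A p * pderiv e1 Z p + B p * pderiv e2 Z p.

Definition homeo_onto_image (X Y : topologicalType) (D : set X) (F : X -> Y) :=
  exists G : Y -> X,
    [/\ {within D, continuous F}, forall x, D x -> G (F x) = x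
      & {within F @` D, continuous G}].

End Regularity.

Section Boundary.
Context {R : realType}.

Definition C1_regular_simple_arc (g1 g2 : R -> R) : Prop :=
  [/\ (forall t, derivable g1 t 1) /\ continuous (derive1 g1),
      (forall t, derivable g2 t 1) /\ continuous (derive1 g2),
      (forall t, t \in `[0, 1] -> ~ (derive1 g1 t = 0 /\ derive1 g2 t = 0)) &
      {in `[0, 1] &, injective (fun t => (g1 t, g2 t))}].

(* A finite union of regular simple C^1 arcs that meet only at end points.
   Taking the parametrizations to be C^1 on the whole line is no restriction,
   since C^1 functions on [0, 1] extend. *)
Definition piecewise_C1 (E : set (R * R)) : Prop :=
  exists (n : nat) (g1 g2 : 'I_n -> R -> R),
    [/\ forall i, C1_regular_simple_arc (g1 i) (g2 i),
        forall i j s t, i != j -> s \in `[0, 1] -> t \in `[0, 1] ->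
          (g1 i s, g2 i s) = (g1 j t, g2 j t) ->
          (s = 0 \/ s = 1) /\ (t = 0 \/ t = 1) &
        E = [set p | exists i t, t \in `[0, 1] /\ p = (g1 i t, g2 i t)]].

End Boundary.

Section Hypocomplex.
Context {R : realType}.
Implicit Types (A B Z : R * R -> R[i]) (S K U : set (R * R)).

Definition charfun A B (p : R * R) : R := Im (A p * (B p)^*).

Definition charset A B K : set (R * R) := [set p | K p /\ charfun A B p = 0].

Definition hypocomplex_at A B (D : set (R * R)) (p : R * R) : Prop :=
  exists (U : set (R * R)) Z,
    [/\ open U, U p & U `<=` D] /\
    [/\ C1eps_cplx U Z, forall q, U q -> dZ_neq0 Z q,
        forall q, U q -> vf_apply A B Z q = 0
      & homeo_onto_image U (Z : R * R -> R[i]^o)].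

(* [rho] is a C^{1+eps} defining function in [U] of the curve [S], which is
   contained in the closed set [K] and may end on the boundary of [K]. *)
Definition defining_function S K U (rho : R * R -> R) : Prop :=
  [/\ C1eps U rho,
      forall q, U q -> rho q = 0 -> ~ ('D_e1 rho q = 0 /\ 'D_e2 rho q = 0)
    & forall q, U q -> (S q <-> K q /\ rho q = 0)].

Definition C1eps_curve S K : Prop :=
  forall p, S p -> exists (U : set (R * R)) rho,
    [/\ open U, U p & defining_function S K U rho].

(* T_p S = ker (d rho)(p), which does not depend on the defining function. *)
Definition tangent S K (p : R * R) : set (R * R) :=
  [set v | exists (U : set (R * R)) rho,
     [/\ open U, U p, defining_function S K U rho
       & v.1 * 'D_e1 rho p + v.2 * 'D_e2 rho p = 0]].

(* C (x) T = T + i T. *)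
Definition complexification (T : set (R * R)) : set (R[i] * R[i]) :=
  [set w | T (Re w.1, Re w.2) /\ T (Im w.1, Im w.2)].

Definition nontangent A B S K : Prop :=
  forall p, S p -> ~ complexification (tangent S K p) (A p, B p).

Definition degeneracy_exponent A B (D : set (R * R)) S K (p : R * R) (s : R) :=
  exists (U : set (R * R)) (rho g : R * R -> R),
    [/\ open U, U p & U `<=` D] /\
    [/\ defining_function S K U rho, {within U, continuous g},
        forall q, U q -> g q <> 0
      & forall q, U q -> charfun A B q = `|rho q| `^ s * g q].

End Hypocomplex.

Section Integration.
Context {R : realType}.

Definition leb2 : set (measurableTypeR R * measurableTypeR R) -> \bar R :=
  (lebesgue_measure \x lebesgue_measure)%E.

Definition cmod (z : R[i]) : R := ComplexField.Normc.normc z.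

Definition Lq (W : set (R * R)) (q : R) (f : R * R -> R[i]) : Prop :=
  let M : set (measurableTypeR R * measurableTypeR R) := W in
  [/\ measurable_fun M (fun p => Re (f p)),
      measurable_fun M (fun p => Im (f p))
    & (Lnorm leb2 q%:E ((fun p => (cmod (f p))%:E) \_ M) < +oo)%E].

Definition cintegrable (W : set (R * R)) (f : R * R -> R[i]) : Prop :=
  let M : set (measurableTypeR R * measurableTypeR R) := W in
  leb2.-integrable M (fun p => (Re (f p))%:E) /\
  leb2.-integrable M (fun p => (Im (f p))%:E).

Definition cintegral (W : set (R * R)) (f : R * R -> R[i]) : R[i] :=
  let M : set (measurableTypeR R * measurableTypeR R) := W in
  Rintegral leb2 M (fun p => Re (f p)) +i* Rintegral leb2 M (fun p => Im (f p)).

Definition TZ_kernel (Z f : R * R -> R[i]) (p zeta : R * R) : R[i] :=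
  f zeta / (Z zeta - Z p).

Definition TZ (W : set (R * R)) (Z f : R * R -> R[i]) (p : R * R) : R[i] :=
  (2 * pi%:C * 'i)^-1 * cintegral W (TZ_kernel Z f p).

End Integration.

(* Main.v *)
Require Import Defs.
From HB Require Import structures.
From mathcomp Require Import all_boot all_order all_algebra.
From mathcomp Require Import complex.
From mathcomp Require Import all_classical all_reals all_analysis.
From mathcomp Require Import measurable_realfun.
From mathcomp Require Import ring lra.
Import Order.TTheory GRing.Theory Num.Theory.
Import numFieldNormedType.Exports.
Local Open Scope classical_set_scope.
Local Open Scope ring_scope.
Local Open Scope complex_scope.


(** Write [u] and [v] for the real and imaginary parts of [Z], [J] for the
    Jacobian of [(u, v)], and [tau = 2 - sigma / (sigma + 1)].

    The theorem follows from a bound, uniform in [z0], of the integral over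
    [Omega] of [|Z(p) - z0|^(-q)] for [1 <= q < tau] ([kernel_integral_le]).
    Indeed [|T_Z f(p)|] is at most [T(p)], the integral of [|f| k] with
    [k = 1 / |Z(zeta) - Z(p)|], while by Tonelli's theorem the integral [S(p)]
    of [|f| k^q] is integrable over [Omega]. The inequality
    [k <= a + a^(1 - q) k^q], with [a = (S(p) + 1)^(1/q)], gives
    [T(p)^q <= (M + 1)^q (S(p) + 1)] where [M] bounds the integral of [|f|]
    ([integral_potential1_poweR]); the same inequality shows that [T] is finite
    almost everywhere, so that the integral defining [T_Z f] converges.

    By a dyadic layer-cake argument ([dyadic_layer_cake]), the uniform bound
    reduces to the estimate [C r^tau], with [C] independent of the square, for
    the area of the part of [Omega] that [Z] maps into a square of side of order
    [r]. By compactness it is enough to prove this near each point of the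
    closure of [Omega] ([small_preimages]). The tool is an area inequality
    ([area_inequality]): if [F] is injective on an open set [E], strictly
    differentiable, and if its Jacobian is at least [m] in absolute value, then
    [m |E| <= 32 |F(E)|].
    - Near a point where [J] does not vanish, it gives [C r^2].
    - Near a point of the characteristic set, [|J| >= c |rho|^s] on [Omega], and
      since [L] is not tangent to the curve [rho = 0], one of the maps
      [(u, rho)], [(v, rho)] has a nonzero Jacobian. For [dl > 0], the area
      inequality for that map bounds the part where [|rho| < 2 dl] by [C r dl],
      and the area inequality for [Z] bounds the part where [|rho| > dl] by
      [C r^2 / dl^s]. Both are of order [r^(2 - s / (s + 1))] when
      [dl = r^(1 / (s + 1))].

    Areas of preimages are estimated, rather than distances
    [|Z(p) - Z(p')|] from below, because near the boundary two close points of
    [Omega] may lie on opposite sides of a thin piece of the complement, where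
    [Z] is not controlled; the area inequality uses only the injectivity of [Z]
    on [Omega]. *)


Set Implicit Arguments.
Unset Strict Implicit.
Unset Printing Implicit Defensive.


(** * Open and closed sets of the plane and their measure *)

Section Plane.
Context {R : realType}.
Local Notation mR := (measurableTypeR R).
Implicit Types (p q : R * R) (E K : set (R * R)).

(** The open square of centre [p] and half-side [d]. *)
Definition box p (d : R) : set (R * R) :=
  [set q | `|q.1 - p.1| < d /\ `|q.2 - p.2| < d].

(** The closed square of centre [p] and half-side [d]. *)
Definition cbox p (d : R) : set (R * R) :=
  [set q | `|q.1 - p.1| <= d /\ `|q.2 - p.2| <= d].

Lemma nbhs_boxP p E : nbhs p E <-> exists2 d, 0 < d & box p d `<=` E.
Proof.
split.
  move=> /nbhs_ballP[d /= d0 dE]; exists d => // q [q1 q2]; apply: dE.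
  by split => /=; rewrite /ball/= distrC.
move=> [d d0 dE]; apply/nbhs_ballP; exists d => //= q [q1 q2]; apply: dE.
by split => /=; rewrite distrC.
Qed.

Lemma open_boxP E :
  open E <-> forall p, E p -> exists2 d, 0 < d & box p d `<=` E.
Proof.
rewrite openE; split => [oE p Ep|h p /h/nbhs_boxP//].
by have /nbhs_boxP := oE _ Ep.
Qed.

Lemma box_center p d : 0 < d -> box p d p.
Proof. by move=> d0; rewrite /box/= !subrr normr0. Qed.

Lemma box_open p d : open (box p d).
Proof.
apply/open_boxP => q [q1 q2].
exists (Num.min (d - `|q.1 - p.1|) (d - `|q.2 - p.2|)).
  by rewrite lt_min !subr_gt0 q1 q2.
move=> s [s1 s2]; move: s1 s2; rewrite !lt_min => /andP[a1 a2] /andP[b1 b2].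
split.
  by have := ler_distD q.1 s.1 p.1; lra.
by have := ler_distD q.2 s.2 p.2; lra.
Qed.

Lemma sub_box p d1 d2 : d1 <= d2 -> box p d1 `<=` box p d2.
Proof. by move=> d12 q [q1 q2]; split; apply: lt_le_trans d12. Qed.

Lemma boxE p d : box p d =
  [set` `]p.1 - d, p.1 + d[%R] `*` [set` `]p.2 - d, p.2 + d[%R].
Proof.
apply/seteqP; split => q /=; rewrite /box/= !in_itv/= !ltr_distl.
  by move=> [-> ->].
by move=> [-> ->].
Qed.

Lemma measurable_box p d : measurable (box p d : set (mR * mR)).
Proof. by rewrite boxE; apply: measurableX; exact: measurable_itv. Qed.

Lemma open_measurable2 E : open E -> measurable (E : set (mR * mR)).
Proof.
move=> oE.
pose F (k : rat * rat * rat) : set (mR * mR) :=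
  let b := box (ratr k.1.1, ratr k.1.2) (ratr k.2) in
  if `[< b `<=` E >] then b else set0.
have -> : E = \bigcup_k F k.
  apply/seteqP; split => [p Ep|p [k _]]; last first.
    by rewrite /F; case: asboolP => // kE /kE.
  have [d d0 dE] := (open_boxP E).1 oE _ Ep.
  have [r] := @rat_in_itvoo R (d / 4) (d / 2) ltac:(lra).
  have [a] := @rat_in_itvoo R (p.1 - d / 4) (p.1 + d / 4) ltac:(lra).
  have [b] := @rat_in_itvoo R (p.2 - d / 4) (p.2 + d / 4) ltac:(lra).
  rewrite !in_itv/= => /andP[b1 b2] /andP[a1 a2] /andP[r1 r2].
  exists (a, b, r) => //; rewrite /F/=.
  case: asboolP => [_|[]].
    by rewrite /box/=; split; rewrite ltr_distl; lra.
  move=> q [/=]; rewrite !ltr_distl => q1 q2; apply: dE.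
  by split; rewrite ltr_distl; lra.
apply: countable_bigcupT_measurable => [|k].
  exact: countableP.
rewrite /F; case: asboolP => _; last exact: measurable0.
exact: measurable_box.
Qed.

Lemma closed_measurable2 E : closed E -> measurable (E : set (mR * mR)).
Proof.
move=> cE; rewrite -(setCK E); apply: measurableC.
by apply: open_measurable2; exact: closed_openC.
Qed.

(** An open subset of the plane is an increasing union of compact sets: the
    points at distance at least [1 / (n + 1)] from the complement, in the
    square of half-side [n]. *)
Lemma open_exhaustion E : open E -> exists K : (set (R * R))^nat,
  [/\ forall n, compact (K n), {homo K : m n / (m <= n)%N >-> m `<=` n}
    & E = \bigcup_n K n].
Proof.
move=> oE.
pose K n : set (R * R) := [set p | (`|p.1| <= n%:R /\ `|p.2| <= n%:R) /\
  forall q, ~ E q -> ~ box q n.+1%:R^-1 p].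
exists K; split.
- move=> n.
  have -> : K n = ([set` `[- n%:R : R, n%:R]%R] `*` [set` `[- n%:R : R, n%:R]%R])
      `&` ~` \bigcup_(q in ~` E) box q n.+1%:R^-1.
    apply/seteqP; split => p /=; rewrite !in_itv/= -!ler_norml.
      move=> [[p1 p2] h]; split => // -[q Eq].
      exact: h.
    by move=> [[p1 p2] h]; split => // q Eq qp; apply: h; exists q.
  apply: (@subclosed_compact _ _
      ([set` `[- n%:R : R, n%:R]%R] `*` [set` `[- n%:R : R, n%:R]%R])).
  + apply: closedI.
      apply: compact_closed; first exact: norm_hausdorff.
      by apply: compact_setX; exact: segment_compact.
    apply: open_closedC; apply: bigcup_open => q _; exact: box_open.
  + by apply: compact_setX; exact: segment_compact.
  + by move=> p [].
- move=> m n mn p [[p1 p2] h]; split.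
    by split; rewrite (le_trans _ (_ : m%:R <= _)) ?ler_nat.
  move=> q Eq qp; apply: (h q) => //; apply: sub_box qp.
  by rewrite lef_pV2 ?posrE ?ltr0n// ler_nat.
- apply/seteqP; split => [p Ep|p [n _ [_ h]]]; last first.
    apply: contrapT => Ep; apply: (h p) => //; apply: box_center.
    by rewrite invr_gt0 ltr0n.
  have [d d0 dE] := (open_boxP E).1 oE _ Ep.
  pose M := `|p.1| + `|p.2| + d^-1.
  have M0 : 0 <= M by rewrite /M !addr_ge0// invr_ge0 ltW.
  have /andP[_ hM] := truncn_itv M0.
  have dV : 0 < d^-1 by rewrite invr_gt0.
  have a1 : 0 <= `|p.1| by []. have a2 : 0 <= `|p.2| by [].
  exists (Num.truncn M).+1 => //; split.
    by split; apply/ltW; apply: le_lt_trans hM; rewrite /M; lra.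
  move=> q Eq [q1 q2]; apply/Eq/dE; split; rewrite distrC.
    apply: (lt_le_trans q1).
    rewrite -[leRHS]invrK lef_pV2 ?posrE ?invr_gt0// ?ltr0n//.
    apply/ltW/(@le_lt_trans _ _ M); first by rewrite /M; lra.
    by apply: (lt_le_trans hM); rewrite ler_nat.
  apply: (lt_le_trans q2).
  rewrite -[leRHS]invrK lef_pV2 ?posrE ?invr_gt0// ?ltr0n//.
  apply/ltW/(@le_lt_trans _ _ M); first by rewrite /M; lra.
  by apply: (lt_le_trans hM); rewrite ler_nat.
Qed.

Lemma measurable_image_open (F : R * R -> R * R) E : open E ->
  (forall p, E p -> {for p, continuous F}) ->
  measurable (F @` E : set (mR * mR)).
Proof.
move=> oE cF; have [K [cK _ EK]] := open_exhaustion oE.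
rewrite {1}EK image_bigcup; apply: bigcup_measurable => n _.
apply: closed_measurable2; apply: compact_closed; first exact: norm_hausdorff.
apply: continuous_compact; last exact: cK.
apply: continuous_in_subspaceT => p; rewrite inE => Kp.
by apply: cF; rewrite EK; exists n.
Qed.

Lemma sub_box_cbox p d : box p d `<=` cbox p d.
Proof. by move=> q [q1 q2]; split; exact: ltW. Qed.

Lemma cbox_sub_box c k p d : cbox c k p -> k < d / 2 -> cbox c k `<=` box p d.
Proof.
move=> [p1 p2] kd q [q1 q2]; split.
  by have := ler_distD c.1 q.1 p.1; rewrite (distrC c.1); lra.
by have := ler_distD c.2 q.2 p.2; rewrite (distrC c.2); lra.
Qed.

Lemma cboxE p d : cbox p d =
  [set` `[p.1 - d, p.1 + d]%R] `*` [set` `[p.2 - d, p.2 + d]%R].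
Proof.
apply/seteqP; split => q /=; rewrite /cbox/= !in_itv/= !ler_distl.
  by move=> [-> ->].
by move=> [-> ->].
Qed.

Lemma measurable_cbox p d : measurable (cbox p d : set (mR * mR)).
Proof. by rewrite cboxE; apply: measurableX; exact: measurable_itv. Qed.

Lemma leb2_ge0 (A : set (R * R)) : (0 <= leb2 A)%E.
Proof. exact: measure_ge0. Qed.

Lemma leb2_le (A B : set (R * R)) : measurable (A : set (mR * mR)) ->
  measurable (B : set (mR * mR)) -> A `<=` B -> (leb2 A <= leb2 B)%E.
Proof. by move=> mA mB AB; apply: le_measure => //; rewrite inE. Qed.

Lemma leb2_rect (a b c d : R) : a <= b -> c <= d ->
  leb2 ([set` `[a, b]%R] `*` [set` `[c, d]%R]) = ((b - a) * (d - c))%:E.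
Proof.
move=> ab cd; rewrite /leb2 product_measure1E; try exact: measurable_itv.
have E (x y : R) : x <= y -> lebesgue_measure [set` `[x, y]%R] = (y - x)%:E.
  move=> xy; rewrite lebesgue_measure_itv/= lte_fin.
  by move: xy; rewrite le_eqVlt => /predU1P[->|->//]; rewrite ltxx subrr.
by rewrite EFinM; congr (_ * _)%E; exact: E.
Qed.

Lemma leb2_cbox p d : 0 <= d -> leb2 (cbox p d) = (4 * d ^+ 2)%:E.
Proof.
move=> d0; rewrite cboxE leb2_rect; [|lra|lra].
by congr (_%:E); ring.
Qed.

Lemma leb2_lty E : measurable (E : set (mR * mR)) -> compact (closure E) ->
  (leb2 E < +oo)%E.
Proof.
move=> mE cE; have [M [_ hM]] := compact_bounded cE.
pose k := `|M| + 1.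
have k0 : 0 < k by rewrite ltr_wpDl.
have EB : E `<=` cbox (0, 0) k.
  move=> q Eq; have : `|q| <= k.
    apply: hM; last exact: subset_closure.
    by rewrite /k (le_lt_trans (ler_norm M))// ltrDl.
  by rewrite /cbox/= !subr0 [X in X <= _]prod_normE ge_max => /andP[].
apply: le_lt_trans (leb2_le mE (measurable_cbox _ _) EB) _.
by rewrite leb2_cbox ?ltry// ltW.
Qed.

End Plane.


(** * Strict differentiability and the local area estimate *)

Section StrictDiff.
Context {R : realType}.
Local Notation mR := (measurableTypeR R).
Implicit Types (p q c : R * R) (u w : R * R -> R) (E K : set (R * R)).

(** On [E], the function [u] differs from the linear form [a x + b y] by a
    function with Lipschitz constant [e] for the l^1 norm. *)
Definition lin_approx u a b e E : Prop := forall p q, E p -> E q ->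
  `|u p - u q - (a * (p.1 - q.1) + b * (p.2 - q.2))| <=
  e * (`|p.1 - q.1| + `|p.2 - q.2|).

(** Strict differentiability of [u] at [p], with partial derivatives [a], [b]. *)
Definition sdiff u p a b : Prop :=
  forall e, 0 < e -> exists2 d, 0 < d & lin_approx u a b e (box p d).

Lemma lin_approx_cont u a b e E : open E -> lin_approx u a b e E ->
  forall p, E p -> {for p, continuous u}.
Proof.
move=> /open_boxP oE h p Ep; apply/cvgrPdist_le => /= x x0.
pose M := `|a| + `|b| + `|e| + 1.
have M0 : 0 < M by rewrite /M ltr_wpDl// !addr_ge0.
have [d d0 dE] := oE _ Ep.
apply/nbhs_boxP; exists (Num.min d (x / (2 * M))).
  by rewrite lt_min d0 divr_gt0// mulr_gt0.
move=> q [/=]; rewrite !lt_min => /andP[q1d q1] /andP[q2d q2].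
have Eq : E q by apply: dE.
have := h _ _ Ep Eq; rewrite (distrC p.1) (distrC p.2).
move: q1 q2; rewrite !ltr_pdivlMr ?mulr_gt0// => q1 q2 huv.
set X := `|q.1 - p.1| in q1 huv; set Y := `|q.2 - p.2| in q2 huv.
have X0 : 0 <= X by rewrite normr_ge0.
have Y0 : 0 <= Y by rewrite normr_ge0.
have e1 : e * (X + Y) <= `|e| * (X + Y) by apply: ler_wpM2r; [exact: addr_ge0|exact: ler_norm].
have l1 : `|a * (p.1 - q.1)| <= `|a| * X by rewrite normrM distrC.
have l2 : `|b * (p.2 - q.2)| <= `|b| * Y by rewrite normrM distrC.
have l3 := ler_normD (a * (p.1 - q.1)) (b * (p.2 - q.2)).
have l4 := ler_normD (u p - u q - (a * (p.1 - q.1) + b * (p.2 - q.2)))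
  (a * (p.1 - q.1) + b * (p.2 - q.2)).
rewrite subrK in l4.
have l5 : 0 <= `|a| * Y by rewrite mulr_ge0.
have l6 : 0 <= `|b| * X by rewrite mulr_ge0.
have : `|u p - u q| <= M * (X + Y) by rewrite /M; lra.
by lra.
Qed.

Lemma continuous_pair_at u w p : {for p, continuous u} -> {for p, continuous w} ->
  {for p, continuous (fun q => (u q, w q))}.
Proof.
move=> cu cw.
exact: (@cvg_pair _ _ _ (nbhs p) (nbhs (u p)) (nbhs (w p)) _ _ _ u w cu cw).
Qed.

Lemma lipschitz_within (f : R -> R) (a b L : R) :
  (forall x y, a <= x <= b -> a <= y <= b -> `|f x - f y| <= L * `|x - y|) ->
  {within `[a, b], continuous f}.
Proof.
move=> fL; apply/subspace_continuousP => x /=; rewrite in_itv/= => xab.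
apply/cvgrPdist_le => /= e e0.
rewrite near_withinE; near=> y => /=; rewrite in_itv/= => yab.
apply: (le_trans (fL _ _ xab yab)).
apply: (@le_trans _ _ ((`|L| + 1) * `|x - y|)).
  by apply: ler_wpM2r => //; apply: (le_trans (ler_norm L)); rewrite lerDl.
have L0 : 0 < `|L| + 1 by rewrite ltr_wpDl.
rewrite mulrC -ler_pdivlMr//.
near: y.
have : 0 < e / (`|L| + 1) by rewrite divr_gt0.
move=> d0; exists (e / (`|L| + 1)) => // y /= /ltW//.
Unshelve. all: by end_near. Qed.

Lemma itv_minmax_measure (s t m : R) : m <= `|s - t| ->
  (m%:E <= lebesgue_measure [set` `[Num.min s t, Num.max s t]%R])%E.
Proof.
move=> h; rewrite lebesgue_measure_itv/= lte_fin.
have e : Num.max s t - Num.min s t = `|s - t|.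
  case: (leP s t) => st; first by rewrite distrC ger0_norm ?subr_ge0.
  by rewrite ger0_norm// subr_ge0 ltW.
case: ltP => [_|le]; first by rewrite -EFinB lee_fin e.
by rewrite lee_fin (le_trans h)// -e subr_le0.
Qed.

(** The local area estimate on one square, when the partial derivative [a] of [u]
    dominates [b]. The equation [u (x, y) = s] is solved for [x] on horizontal
    segments, and [w] moves along each level curve of [u] with speed about [J / a];
    the slice of the image over [s] is therefore at least as long as the range of
    [w] on the curve, and the measure of the image is the integral of the lengths
    of its slices. *)
Section LocalArea.
Variables (u w : R * R -> R) (c : R * R) (k a b a' b' e : R).
Hypothesis k0 : 0 < k.
Hypothesis e0 : 0 <= e.
Hypothesis hu : lin_approx u a b e (box c k).
Hypothesis hw : lin_approx w a' b' e (box c k).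
Let J := a * b' - b * a'.
Hypothesis ba : `|b| <= `|a|.
Hypothesis a0 : 0 < `|a|.
Hypothesis ea : e <= `|a| / 4.
Hypothesis eJ : 6 * e * (`|a| + `|a'|) <= `|J|.

Let F p := (u p, w p).

Let inbox x y : `|x - c.1| <= 3 / 4 * k -> `|y - c.2| <= k / 4 ->
  box c k (x, y).
Proof. by move=> hx hy; rewrite /box/=; split; move: k0; lra. Qed.

Let contu p : box c k p -> {for p, continuous u}.
Proof. move=> hp; exact: (lin_approx_cont (@box_open _ c k) hu hp). Qed.

Let contw p : box c k p -> {for p, continuous w}.
Proof. move=> hp; exact: (lin_approx_cont (@box_open _ c k) hw hp). Qed.

(* Intermediate values on the horizontal segment at height [y]. *)
Let solve_x s y : `|s - u c| <= `|a| * k / 4 -> `|y - c.2| <= k / 4 ->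
  exists2 x, `|x - c.1| <= 3 / 4 * k & u (x, y) = s.
Proof.
move=> hs hy.
have cb : box c k c by exact: box_center.
have b1 : `|b * (y - c.2)| <= `|a| * k / 4.
  rewrite normrM -mulrA; apply: ler_pM => //.
have := hu (@inbox (c.1 + 3 / 4 * k) y _ hy) cb.
have := hu (@inbox (c.1 - 3 / 4 * k) y _ hy) cb.
have en1 : `|c.1 - 3 / 4 * k - c.1| = 3 / 4 * k.
  by rewrite addrC addKr normrN ger0_norm//; move: k0; lra.
have en2 : `|c.1 + 3 / 4 * k - c.1| = 3 / 4 * k.
  by rewrite addrC addKr ger0_norm//; move: k0; lra.
rewrite /= !en1 !en2 => /(_ (lexx _)) h1 /(_ (lexx _)) h2.
have ek : e * (3 / 4 * k + `|y - c.2|) <= `|a| / 4 * k.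
  by apply: ler_pM => //; move: k0 hy; have := normr_ge0 (y - c.2); lra.
have {}h1 := le_trans h1 ek; have {}h2 := le_trans h2 ek.
have cf : {within `[c.1 - 3 / 4 * k, c.1 + 3 / 4 * k], continuous (fun x => u (x, y))}.
  apply: (@lipschitz_within _ _ _ (`|a| + e)) => x1 x2 hx1 hx2.
  have i1 : box c k (x1, y) by apply: inbox => //; rewrite ler_distl.
  have i2 : box c k (x2, y) by apply: inbox => //; rewrite ler_distl.
  have := hu i1 i2; rewrite /= subrr normr0 mulr0 !addr0 => h.
  have := ler_normD (u (x1, y) - u (x2, y) - a * (x1 - x2)) (a * (x1 - x2)).
  by rewrite subrK normrM => /le_trans; apply; rewrite mulrDl addrC lerD2l.
have [||x] := @IVT R (fun x => u (x, y)) _ _ s _ cf.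
- by move: k0; lra.
- move: h1 h2.
  have -> : c.1 - 3 / 4 * k - c.1 = - (3 / 4 * k) by ring.
  have -> : c.1 + 3 / 4 * k - c.1 = 3 / 4 * k by ring.
  move: hs b1; rewrite !ler_norml ge_min le_max.
  case: (ltP 0 a) => [ap|an].
    rewrite gtr0_norm// => /andP[s1 s2] /andP[b1 b2] /andP[l1 l2] /andP[l3 l4].
    by apply/andP; split; apply/orP; [left|right]; lra.
  rewrite ler0_norm// => /andP[s1 s2] /andP[b1 b2] /andP[l1 l2] /andP[l3 l4].
  by apply/andP; split; apply/orP; [right|left]; lra.
- by rewrite in_itv/= => hx <-; exists x => //; rewrite ler_distl.
Qed.

Let slice_ge s : `|s - u c| <= `|a| * k / 4 ->
  ((`|J| * k / 4 / `|a|)%:E <=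
   lebesgue_measure (xsection (F @` box c k : set (mR * mR)) s))%E.
Proof.
move=> hs.
have /choice[X hX] : forall y, exists x, `|y - c.2| <= k / 4 ->
    `|x - c.1| <= 3 / 4 * k /\ u (x, y) = s.
  move=> y; have [hy|hy] := boolP (`|y - c.2| <= k / 4); last by exists 0.
  by have [x x1 x2] := solve_x hs hy; exists x.
have XL y1 y2 : `|y1 - c.2| <= k / 4 -> `|y2 - c.2| <= k / 4 ->
    `|X y1 - X y2| <= 2 * `|y1 - y2| /\
    `|a * (w (X y1, y1) - w (X y2, y2)) - J * (y1 - y2)| <= `|J| / 2 * `|y1 - y2|.
  move=> h1 h2; have [x1 s1] := hX _ h1; have [x2 s2] := hX _ h2.
  have := hu (inbox x1 h1) (inbox x2 h2).
  have := hw (inbox x1 h1) (inbox x2 h2).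
  rewrite /= s1 s2 subrr sub0r normrN.
  set dx := X y1 - X y2; set dy := y1 - y2; set dw := w _ - _.
  move=> hdw hdu.
  have hb : `|b * dy| <= `|a| * `|dy| by rewrite normrM ler_wpM2r.
  have hx : `|a| * `|dx| <= `|a * dx + b * dy| + `|b * dy|.
    rewrite -normrM; have := ler_normB (a * dx + b * dy) (b * dy).
    by rewrite addrK.
  have ee : e * (`|dx| + `|dy|) <= `|a| / 4 * (`|dx| + `|dy|).
    by rewrite ler_wpM2r// addr_ge0.
  have dx2 : `|dx| <= 2 * `|dy|.
    rewrite -(ler_pM2l a0); have := mulr_ge0 (normr_ge0 a) (normr_ge0 dy).
    by move: hx ee hb hdu; lra.
  split => //.
  have -> : a * dw - J * dy =
      a * (dw - (a' * dx + b' * dy)) + a' * (a * dx + b * dy).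
    by rewrite /J; ring.
  apply: (le_trans (ler_normD _ _)); rewrite !normrM.
  have t1 : `|a| * `|dw - (a' * dx + b' * dy)| <= `|a| * (e * (3 * `|dy|)).
    apply: ler_wpM2l => //; apply: (le_trans hdw); apply: ler_wpM2l => //; lra.
  have t2 : `|a'| * `|a * dx + b * dy| <= `|a'| * (e * (3 * `|dy|)).
    apply: ler_wpM2l => //; apply: (le_trans hdu); apply: ler_wpM2l => //; lra.
  have t3 : 6 * e * (`|a| + `|a'|) * `|dy| <= `|J| * `|dy| by rewrite ler_wpM2r.
  by lra.
(* [psi] is [w] along the level curve [u = s]. *)
pose psi y := w (X y, y).
have hy1 : `|c.2 - k / 4 - c.2| <= k / 4.
  by rewrite addrC addKr normrN ger0_norm//; move: k0; lra.
have hy2 : `|c.2 + k / 4 - c.2| <= k / 4.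
  by rewrite addrC addKr ger0_norm//; move: k0; lra.
have cpsi : {within `[c.2 - k / 4, c.2 + k / 4], continuous psi}.
  apply: (@lipschitz_within _ _ _ (2 * `|J| / `|a|)) => y1 y2.
  rewrite -!ler_distl => h1 h2; have [_] := XL _ _ h1 h2.
  rewrite -/(psi _) -/(psi _); set dp := psi _ - _; set dy := y1 - y2 => h.
  have := ler_normD (a * dp - J * dy) (J * dy); rewrite subrK !normrM => h'.
  rewrite -(ler_pM2l a0).
  rewrite (_ : `|a| * (2 * `|J| / `|a| * `|dy|) = 2 * (`|J| * `|dy|)); last first.
    by field; rewrite gt_eqF.
  by have := mulr_ge0 (normr_ge0 J) (normr_ge0 dy); move: h h'; lra.
have mF : measurable (F @` box c k : set (mR * mR)).
  apply: (@measurable_image_open _ F _ (@box_open _ c k)) => p Ep.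
  by apply: continuous_pair_at; [exact: contu|exact: contw].
have := le_trans _ (@le_measure _ _ _ (@lebesgue_measure R) _ _ _ _
  (_ : [set` `[Num.min (psi (c.2 - k / 4)) (psi (c.2 + k / 4)),
         Num.max (psi (c.2 - k / 4)) (psi (c.2 + k / 4))]%R] `<=`
    xsection (F @` box c k : set (mR * mR)) s)); apply.
- apply: itv_minmax_measure.
  have [_] := XL _ _ hy2 hy1; rewrite -/(psi _) -/(psi _).
  rewrite (_ : c.2 + k / 4 - (c.2 - k / 4) = k / 2); last by field.
  rewrite (@ger0_norm _ (k / 2)); last by move: k0; lra.
  rewrite [X in _ -> _ <= X]distrC; set dp := psi _ - _ => h.
  have := ler_normB (a * dp - J * (k / 2)) (a * dp).
  rewrite [X in `|X|](_ : _ = - (J * (k / 2))); last by ring.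
  rewrite normrN (normrM J) (normrM a) (@ger0_norm _ (k / 2)); last by move: k0; lra.
  rewrite ler_pdivrMr// => h'.
  by lra.
- by rewrite inE; exact: measurable_itv.
- rewrite inE; exact: (measurable_xsection (T1 := mR) (T2 := mR) s mF).
- move=> t /=; rewrite in_itv/= => ht.
  have [|y] := @IVT R psi _ _ t _ cpsi ht; first by move: k0; lra.
  rewrite in_itv/= -ler_distl => hy <-.
  rewrite /xsection/= inE/=; exists (X y, y).
    by apply: inbox => //; have [] := hX _ hy.
  by rewrite /F/= -/(psi y); have [_ ->] := hX _ hy.
Qed.

Lemma local_area_aux :
  ((`|J| * (k ^+ 2 / 8))%:E <= leb2 (F @` box c k))%E.
Proof.
pose I : set mR := [set` `[u c - `|a| * k / 4, u c + `|a| * k / 4]%R].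
have mI : measurable I by exact: measurable_itv.
have mF : measurable (F @` box c k : set (mR * mR)).
  apply: (@measurable_image_open _ F _ (@box_open _ c k)) => p Ep.
  by apply: continuous_pair_at; [exact: contu|exact: contw].
have ak : 0 < `|a| * k / 4 by rewrite divr_gt0// mulr_gt0.
rewrite /leb2 /product_measure1.
pose G (x : mR) : \bar R := lebesgue_measure (xsection (F @` box c k : set (mR * mR)) x).
have mG : measurable_fun [set: mR] G.
  exact: (measurable_fun_xsection (T1 := mR) (T2 := mR) lebesgue_measure mF).
apply: (@le_trans _ _ (\int[lebesgue_measure]_(x in I) G x)%E); last first.
  apply: ge0_subset_integral => //.
apply: (@le_trans _ _ (\int[lebesgue_measure]_(x in I)
  (`|J| * k / 4 / `|a|)%:E)%E); last first.
  apply: ge0_le_integral => //.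
  - by move=> x _; rewrite lee_fin !mulr_ge0// ?invr_ge0// ltW.
  - exact: measurable_funTS.
  - by move=> x; rewrite /I/= in_itv/= -ler_distl => /slice_ge.
rewrite integral_cst//= /I lebesgue_measure_itv/= lte_fin ifT; last by lra.
rewrite -EFinB -EFinM lee_fin le_eqVlt; apply/orP; left; apply/eqP.
by field; rewrite gt_eqF.
Qed.

End LocalArea.

Lemma sdiff_lt u p a b e1 : 0 < e1 -> sdiff u p a b ->
  exists2 d, 0 < d & forall c k, k < d -> cbox c k p -> lin_approx u a b e1 (box c k).
Proof.
move=> e10 /(_ _ e10)[d d0 hd]; exists (d / 2); first by rewrite divr_gt0.
by move=> c k kd cp q r hq hr; apply: hd; apply: (cbox_sub_box cp kd);
  exact: sub_box_cbox.
Qed.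

(** Squares around [p] that are small enough have images by [(u, w)] of measure
    at least [|J| / 32] times their own, [k] being the half-side. *)
Definition local_area_at u w p (J : R) : Prop :=
  exists2 d, 0 < d & forall c k, 0 < k -> k < d -> cbox c k p ->
    ((`|J| * (k ^+ 2 / 8))%:E <= leb2 ((fun q => (u q, w q)) @` box c k))%E.

Lemma local_area_dom u w p a b a' b' : sdiff u p a b -> sdiff w p a' b' ->
  a * b' - b * a' != 0 -> `|b| <= `|a| ->
  local_area_at u w p (a * b' - b * a').
Proof.
move=> su sw J0 ba.
have a0 : 0 < `|a|.
  rewrite normr_gt0; apply: contraNneq J0 => a0; move: ba.
  by rewrite a0 normr0 normr_le0 => /eqP ->; rewrite !mul0r subrr.
have s0 : 0 < 6 * (`|a| + `|a'|) by rewrite mulr_gt0// ltr_pwDl.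
have J1 : 0 < `|a * b' - b * a'| by rewrite normr_gt0.
pose e := Num.min (`|a| / 4) (`|a * b' - b * a'| / (6 * (`|a| + `|a'|))).
have e0 : 0 < e by rewrite lt_min !divr_gt0.
have [d1 d10 h1] := sdiff_lt e0 su; have [d2 d20 h2] := sdiff_lt e0 sw.
exists (Num.min d1 d2); first by rewrite lt_min d10 d20.
move=> c k k0; rewrite lt_min => /andP[kd1 kd2] hp.
apply: (@local_area_aux u w c k a b a' b' e) => //.
- exact: ltW.
- exact: h1.
- exact: h2.
- by rewrite /e ge_min lexx.
- rewrite -mulrA mulrCA -ler_pdivlMr// /e ge_min lexx orbT//.
Qed.

(** The symmetry that exchanges the two coordinates. *)
Definition swap p : R * R := (p.2, p.1).

Lemma box_swap c k p : box (swap c) k (swap p) <-> box c k p.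
Proof. by split => -[]. Qed.

Lemma cbox_swap c k p : cbox (swap c) k (swap p) <-> cbox c k p.
Proof. by split => -[]. Qed.

Lemma sdiff_swap u p a b : sdiff u p a b -> sdiff (u \o swap) (swap p) b a.
Proof.
move=> h e e0; have [d d0 hd] := h _ e0; exists d => // q r hq hr.
have := hd (swap q) (swap r); rewrite /= => /(_ _ _)/=.
rewrite (addrC `|q.2 - r.2|) (addrC (a * _)); apply.
- by apply/(box_swap p d); move: hq; case: q.
- by apply/(box_swap p d); move: hr; case: r.
Qed.

(** A quantitative local form of the area formula, with a constant that does
    not depend on the map: small squares near a point where [(u, w)] is strictly
    differentiable with Jacobian [J] have images of comparable area. *)
Lemma local_area u w p a b a' b' : sdiff u p a b -> sdiff w p a' b' ->
  a * b' - b * a' != 0 -> local_area_at u w p (a * b' - b * a').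
Proof.
move=> su sw J0; have [ba|ab] := leP `|b| `|a|; first exact: local_area_dom.
have J1 : b * a' - a * b' != 0 by rewrite -opprB oppr_eq0.
have [d d0 hd] := local_area_dom (sdiff_swap su) (sdiff_swap sw) J1 (ltW ab).
exists d => // c k k0 kd hp; rewrite -normrN opprB.
have := hd (swap c) k k0 kd ((cbox_swap _ _ _).2 hp).
rewrite (_ : [set _ | _ in box (swap c) k] = [set (u q, w q) | q in box c k])//.
apply/seteqP; split => _ [q hq <-].
  by exists (swap q) => //; apply/(box_swap c k); move: hq; case: q.
by exists (swap q); [apply/box_swap|case: q {hq}].
Qed.

End StrictDiff.


(** * The area inequality *)

Section Area.
Context {R : realType}.
Local Notation mR := (measurableTypeR R).
Implicit Types (p q c : R * R) (u w : R * R -> R) (E K : set (R * R)).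

Lemma nested_itv (a b : R^nat) : (forall n, a n <= a n.+1) ->
  (forall n, b n.+1 <= b n) -> (forall n, a n <= b n) ->
  exists x, forall n, a n <= x <= b n.
Proof.
move=> an bn ab.
have ndA : {homo a : m n / (m <= n)%N >-> m <= n} by exact/nondecreasing_seqP.
have niB : {homo b : m n / (m <= n)%N >-> n <= m} by exact/nonincreasing_seqP.
have abmn m n : a m <= b n.
  apply: (le_trans (ndA m (maxn m n) (leq_maxl _ _))).
  by apply: (le_trans (ab _)); apply: niB; exact: leq_maxr.
exists (sup (range a)) => n; apply/andP; split.
  apply: sup_upper_bound; last by exists n.
  by split; [exists (a 0%N); exists 0%N|exists (b 0%N) => _ [m _ <-]].
by apply: sup_le_ub; [exists (a 0%N); exists 0%N|move=> _ [m _ <-]].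
Qed.

(** The centre of one of the four quarters of the square [cbox c k]. *)
Definition quarter c (k : R) (s : bool * bool) : R * R :=
  (c.1 + (if s.1 then k / 2 else - (k / 2)),
   c.2 + (if s.2 then k / 2 else - (k / 2))).

(** A property of squares that passes from the four quarters to the whole
    square and holds for all small squares around any point holds for all
    squares. *)
Lemma square_bisection (P : R * R -> R -> Prop) :
  (forall c k, 0 < k -> (forall s, P (quarter c k s) (k / 2)) -> P c k) ->
  (forall p, exists2 d, 0 < d &
     forall c k, 0 < k -> k < d -> cbox c k p -> P c k) ->
  forall c k, 0 < k -> P c k.
Proof.
move=> Pq Ploc c0 k0 k00; apply: contrapT => nP.
have /choice[nxt hnxt] : forall x : (R * R) * R, exists y : (R * R) * R,
    0 < x.2 -> ~ P x.1 x.2 -> ~ P y.1 y.2 /\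
    exists s, y = (quarter x.1 x.2 s, x.2 / 2).
  move=> x; have [[x0 nx]|h] := pselect (0 < x.2 /\ ~ P x.1 x.2); last first.
    by exists x => x0 nx; exfalso; apply: h.
  have [s hs] : exists s, ~ P (quarter x.1 x.2 s) (x.2 / 2).
    by apply/existsNP => h; apply: nx; apply: Pq.
  by exists (quarter x.1 x.2 s, x.2 / 2) => _ _; split => //; exists s.
pose x n := iter n nxt (c0, k0).
have xP n : 0 < (x n).2 /\ ~ P (x n).1 (x n).2.
  elim: n => [//|n [x0 xn]]; have [h [s e]] := hnxt _ x0 xn.
  by split; [rewrite /x iterS -/(x n) e divr_gt0|].
have xS n : exists s, x n.+1 = (quarter (x n).1 (x n).2 s, (x n).2 / 2).
  by have [h1 h2] := xP n; have [_] := hnxt _ h1 h2.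
have kn n : (x n).2 = k0 / 2 ^+ n.
  elim: n => [|n IH]; first by rewrite expr0 divr1.
  have [s ->] := xS n; rewrite /= IH exprS; field.
  by rewrite expf_neq0.
have [y1 hy1] : exists y, forall n, (x n).1.1 - (x n).2 <= y <= (x n).1.1 + (x n).2.
  apply: nested_itv => n; have [h _] := xP n; last lra.
  - by have [[[] t] ->] := xS n; rewrite /=; lra.
  - by have [[[] t] ->] := xS n; rewrite /=; lra.
have [y2 hy2] : exists y, forall n, (x n).1.2 - (x n).2 <= y <= (x n).1.2 + (x n).2.
  apply: nested_itv => n; have [h _] := xP n; last lra.
  - by have [[t []] ->] := xS n; rewrite /=; lra.
  - by have [[t []] ->] := xS n; rewrite /=; lra.
have [d d0 hd] := Ploc (y1, y2).
have M0 : 0 <= k0 / d by rewrite divr_ge0// ltW.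
have /andP[_ hM] := truncn_itv M0.
pose n := (Num.truncn (k0 / d)).+1.
have [x0 nx] := xP n; apply: nx; apply: hd => //.
  rewrite kn ltr_pdivrMr ?exprn_gt0// mulrC -ltr_pdivrMr//.
  apply: (lt_trans hM); rewrite -natrX ltr_nat; exact: ltn_expl.
by split; rewrite ler_distl; [exact: (hy1 n)|exact: (hy2 n)].
Qed.

Section AreaLemma.
Variables (u w : R * R -> R) (ux uy wx wy : R * R -> R) (E : set (R * R)) (m : R).
Hypothesis oE : open E.
Hypothesis su : forall p, E p -> sdiff u p (ux p) (uy p).
Hypothesis sw : forall p, E p -> sdiff w p (wx p) (wy p).
Hypothesis m0 : 0 < m.
Hypothesis hJ : forall p, E p -> m <= `|ux p * wy p - uy p * wx p|.
Let F p := (u p, w p).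
Hypothesis injF : forall p q, E p -> E q -> F p = F q -> p = q.

Let contF p : E p -> {for p, continuous F}.
Proof.
have H v a b : sdiff v p a b -> {for p, continuous v}.
  move=> /(_ 1 ltr01)[d d0 hd].
  exact: (lin_approx_cont (@box_open _ p d) hd (box_center p d0)).
by move=> Ep; apply: continuous_pair_at;
  [exact: (H _ _ _ (su Ep))|exact: (H _ _ _ (sw Ep))].
Qed.

Let measF A : open A -> measurable (F @` (A `&` E) : set (mR * mR)).
Proof.
move=> oA; apply: measurable_image_open; first exact: openI.
by move=> p [_ /contF].
Qed.

Let disjF A B : open A -> open B -> A `&` B = set0 ->
  (leb2 (F @` (A `&` E)) + leb2 (F @` (B `&` E)) =
   leb2 (F @` ((A `|` B) `&` E)))%E.
Proof.
move=> oA oB AB; rewrite setIUl image_setU.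
rewrite [RHS]measureU//; try exact: measF.
apply/seteqP; split => // z [[p [Ap Ep] <-] [q [Bq Eq] e]].
have pq := injF Eq Ep e; rewrite pq in Bq.
by have : (A `&` B) p by []; rewrite AB.
Qed.

(* The bisection is applied to the inequality itself, which compares a
   subadditive function of the closed square with a superadditive function of the
   open one: the images of disjoint open squares are disjoint. *)
Let compact_area K c k : closed K -> K `<=` E -> 0 < k ->
  (leb2 (cbox c k `&` K) <= (32 / m)%:E * leb2 (F @` (box c k `&` E)))%E.
Proof.
move=> cK KE; have mK := closed_measurable2 cK.
have mcK c' k' : measurable (cbox c' k' `&` K : set (mR * mR)).
  by apply: measurableI => //; exact: measurable_cbox.
have C0 : 0 <= 32 / m by rewrite divr_ge0// ltW.
move: c k; apply: square_bisection => [c k k0 hs|p].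
  pose Q s := cbox (quarter c k s) (k / 2) `&` K.
  pose B s := box (quarter c k s) (k / 2).
  have mQ s : measurable (Q s : set (mR * mR)) by exact: mcK.
  have oB s : open (B s) by exact: box_open.
  have step (A1 A2 : set (mR * mR)) (x1 x2 : \bar R) : measurable A1 -> measurable A2 ->
      (leb2 A1 <= x1 -> leb2 A2 <= x2 -> leb2 (A1 `|` A2) <= x1 + x2)%E.
    move=> mA1 mA2 h1 h2; apply: (le_trans _ (leeD h1 h2)).
    exact: measureU2.
  have hle : cbox c k `&` K `<=`
      (Q (true, true) `|` Q (true, false)) `|` (Q (false, true) `|` Q (false, false)).
    move=> q [[q1 q2] Kq]; rewrite /Q/cbox/quarter/=.
    move: q1 q2; rewrite !ler_distl => q1 q2.
    have [l1|l1] := leP c.1 q.1; have [l2|l2] := leP c.2 q.2.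
    - by left; left; do 2?split => //=; lra.
    - by left; right; do 2?split => //=; lra.
    - by right; left; do 2?split => //=; lra.
    - by right; right; do 2?split => //=; lra.
  have ge : (B (true, true) `|` B (true, false)) `|` (B (false, true) `|` B (false, false))
      `<=` box c k.
    move=> q; rewrite /B/box/quarter/= !ltr_distl.
    by move=> [[|]|[|]] [q1 q2]; split; lra.
  apply: (@le_trans _ _ (leb2 ((Q (true, true) `|` Q (true, false)) `|`
      (Q (false, true) `|` Q (false, false))))).
    by apply: leb2_le => //; apply: measurableU; apply: measurableU.
  apply: (@le_trans _ _ ((32 / m)%:E * leb2 (F @` (((B (true, true) `|` B (true, false)) `|`
      (B (false, true) `|` B (false, false))) `&` E)))%E); last first.
    apply: lee_wpmul2l; first by rewrite lee_fin.
    apply: leb2_le; [|by apply: measF; exact: box_open|].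
      by apply: measF; apply: openU; apply: openU; exact: oB.
    by apply: image_subset; apply: setSI.
  have d1 s t t' : t != t' -> B (s, t) `&` B (s, t') = set0.
    move=> tt; apply/seteqP; split => // q [[_ +] [_ +]].
    by move: t t' tt => [] [] //= _; rewrite !ltr_distl; lra.
  have d2 t t' : B (true, t) `&` B (false, t') = set0.
    apply/seteqP; split => // q [[+ _] [+ _]].
    by rewrite /= !ltr_distl; lra.
  rewrite -disjF; [|by apply: openU; exact: oB|by apply: openU; exact: oB|]; last first.
    by rewrite setIUr !setIUl !d2 !setU0.
  rewrite -!disjF; try exact: oB; try exact: d1.
  have g0 (x1 x2 y1 y2 : set (R * R)) : ((32 / m)%:E * (leb2 x1 + leb2 x2 + (leb2 y1 + leb2 y2)) =
      (32 / m)%:E * leb2 x1 + (32 / m)%:E * leb2 x2 +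
      ((32 / m)%:E * leb2 y1 + (32 / m)%:E * leb2 y2))%E.
    rewrite ge0_muleDr; [|by apply: adde_ge0; exact: leb2_ge0
                         |by apply: adde_ge0; exact: leb2_ge0].
    by congr (_ + _)%E; rewrite ge0_muleDr//; exact: leb2_ge0.
  rewrite g0.
  apply: (step _ _ _ _); [exact: measurableU|exact: measurableU| |].
    by apply: (step _ _ _ _) => //; exact: hs.
  by apply: (step _ _ _ _) => //; exact: hs.
have [Kp|nKp] := pselect (K p); last first.
  have [d d0 dK] := (open_boxP _).1 (closed_openC cK) p nKp.
  exists (d / 2); first by rewrite divr_gt0.
  move=> c k k0 kd cp; rewrite (_ : _ `&` _ = set0).
    have -> : leb2 (set0 : set (R * R)) = 0%E by exact: measure0.
    by rewrite mule_ge0// leb2_ge0.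
  apply/seteqP; split => // q [qc Kq].
  by have := dK _ (cbox_sub_box cp kd qc).
have Ep := KE _ Kp.
have [d1 d10 h1] := (open_boxP _).1 oE p Ep.
have J0 : ux p * wy p - uy p * wx p != 0.
  by rewrite -normr_gt0; apply: (lt_le_trans m0); exact: hJ.
have [d2 d20 h2] := local_area (su Ep) (sw Ep) J0.
exists (Num.min (d1 / 2) d2); first by rewrite lt_min divr_gt0.
move=> c k k0; rewrite lt_min => /andP[kd1 kd2] cp.
have bE : box c k `&` E = box c k.
  by apply/setIidPl => q /sub_box_cbox /(cbox_sub_box cp kd1)/h1.
rewrite bE; apply: (@le_trans _ _ (4 * k ^+ 2)%:E).
  rewrite -(leb2_cbox c (ltW k0)); apply: leb2_le => //; exact: measurable_cbox.
have := h2 _ _ k0 kd2 cp => h3.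
apply: (@le_trans _ _ ((32 / m)%:E * (m * (k ^+ 2 / 8))%:E)%E).
  rewrite -EFinM lee_fin le_eqVlt; apply/orP; left; apply/eqP; field.
  by rewrite gt_eqF.
apply: lee_wpmul2l; first by rewrite lee_fin.
apply: le_trans h3; rewrite lee_fin; apply: ler_wpM2r; last exact: hJ.
by rewrite divr_ge0// exprn_ge0// ltW.
Qed.

(** Area inequality for an injective, strictly differentiable map of the plane
    whose Jacobian is at least [m] in absolute value. *)
Lemma area_inequality : (leb2 E <= (32 / m)%:E * leb2 (F @` E))%E.
Proof.
have C0 : 0 <= 32 / m by rewrite divr_ge0// ltW.
have [K [cK ndK EK]] := open_exhaustion oE.
have KE n : K n `<=` E by rewrite EK; exact: bigcup_sup.
have clK n : closed (K n).
  by apply: compact_closed; [exact: norm_hausdorff|exact: cK].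
have mK n := closed_measurable2 (clK n).
have mE := open_measurable2 oE.
have mFE : measurable (F @` E : set (mR * mR)).
  by have := measF openT; rewrite setTI.
have hK n : (leb2 (K n) <= (32 / m)%:E * leb2 (F @` E))%E.
  have [M [_ hM]] := compact_bounded (cK n).
  pose k := `|M| + 1.
  have k0 : 0 < k by rewrite ltr_wpDl.
  have KB : K n `<=` cbox (0, 0) k.
    move=> q Kq; have : `|q| <= k.
      by apply: hM => //; rewrite /k (le_lt_trans (ler_norm M))// ltrDl.
    by rewrite /cbox/= !subr0 prod_normE ge_max => /andP[].
  have := compact_area (0, 0) (clK n) (@KE n) k0.
  rewrite (setIidr KB) => /le_trans; apply.
  apply: lee_wpmul2l; first by rewrite lee_fin.
  apply: leb2_le => //; first by apply: measF; exact: box_open.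
  by apply: image_subset; exact: subIsetr.
have cv : (leb2 \o K) x @[x --> \oo] --> leb2 (\bigcup_n K n).
  apply: nondecreasing_cvg_mu => //; first by rewrite -EK.
  by move=> i j ij; apply/subsetPset; exact: ndK.
rewrite {1}EK; rewrite -(cvg_lim _ cv)//.
by apply: lime_le; [apply/cvg_ex; eexists; exact: cv|exact: nearW].
Qed.

End AreaLemma.
End Area.


(** * Strict differentiability of maps of class C^(1+eps) *)

Section C1.
Context {R : realType}.
Local Notation mR := (measurableTypeR R).
Implicit Types (p q c : R * R) (f u w : R * R -> R) (E V : set (R * R)).

Lemma continuous_boxP f p : {for p, continuous f} <->
  forall e, 0 < e -> exists2 d, 0 < d & forall q, box p d q -> `|f q - f p| <= e.
Proof.
split=> [cf e e0|h].
  have /cvgrPdist_le/(_ e e0)/nbhs_boxP[d d0 hd] := cf.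
  by exists d => // q /hd /=; rewrite distrC.
apply/cvgrPdist_le => e e0; have [d d0 hd] := h _ e0.
by apply/nbhs_boxP; exists d => // q /hd /=; rewrite distrC.
Qed.

Lemma loc_holder_continuous eps V f p : open V -> 0 < eps -> loc_holder eps V f ->
  V p -> {for p, continuous f}.
Proof.
move=> oV eps0 hf Vp; have [W [oW Wp] [C hC]] := hf _ Vp.
have [d1 d10 h1] := (open_boxP _).1 (openI oV oW) p (conj Vp Wp).
apply/continuous_boxP => e e0.
have C0 : 0 < `|C| + 1 by rewrite ltr_wpDl.
pose x := e / (`|C| + 1); have x0 : 0 < x by rewrite divr_gt0.
exists (Num.min d1 (x `^ eps^-1)); first by rewrite lt_min d10 powR_gt0.
move=> q [q1 q2]; have VWq : (V `&` W) q.
  by apply: h1; apply: (sub_box _ (conj q1 q2)); rewrite ge_min lexx.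
apply: (le_trans (hC _ _ VWq (conj Vp Wp))).
have hx : `|q - p| `^ eps <= x.
  have -> : x = (x `^ eps^-1) `^ eps.
    by rewrite -powRrM mulVf ?gt_eqF// powRr1// ltW.
  apply: ge0_ler_powR; rewrite ?nnegrE ?powR_ge0 ?(ltW eps0)//.
  rewrite prod_normE/= ge_max; move: q1 q2; rewrite !lt_min.
  by move=> /andP[_ /ltW ->] /andP[_ /ltW ->].
apply: (@le_trans _ _ ((`|C| + 1) * x)); last by rewrite /x mulrC divfK ?gt_eqF.
apply: (@le_trans _ _ ((`|C| + 1) * `|q - p| `^ eps)).
  by apply: ler_wpM2r; [exact: powR_ge0|rewrite (le_trans (ler_norm C))// lerDl].
by apply: ler_wpM2l => //; exact: ltW.
Qed.

Lemma derivable_slice1 f x y : derivable f (x, y) e1 ->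
  is_derive x (1 : R) (fun t => f (t, y)) ('D_e1 f (x, y)).
Proof.
have E : (fun h : R => h^-1 *: (((fun t => f (t, y)) \o shift x) (h *: (1 : R)) - f (x, y))) =
    (fun h => h^-1 *: ((f \o shift (x, y)) (h *: e1) - f (x, y))).
  apply/funext => h /=; congr (_ *: (f _ - _)).
  by apply/pair_equal_spec; rewrite /= scaler0 add0r.
by move=> df; apply: DeriveDef; rewrite /derivable/derive E.
Qed.

Lemma derivable_slice2 f x y : derivable f (x, y) e2 ->
  is_derive y (1 : R) (fun t => f (x, t)) ('D_e2 f (x, y)).
Proof.
have E : (fun h : R => h^-1 *: (((fun t => f (x, t)) \o shift y) (h *: (1 : R)) - f (x, y))) =
    (fun h => h^-1 *: ((f \o shift (x, y)) (h *: e2) - f (x, y))).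
  apply/funext => h /=; congr (_ *: (f _ - _)).
  by apply/pair_equal_spec; rewrite /= scaler0 add0r.
by move=> df; apply: DeriveDef; rewrite /derivable/derive E.
Qed.

(** The error in the first-order expansion of [g] is at most the oscillation of
    its derivative times the increment. *)
Lemma mvt_approx (g dg : R -> R) (c d A e : R) :
  (forall x, `|x - c| < d -> is_derive x (1 : R) g (dg x)) ->
  (forall x, `|x - c| < d -> `|dg x - A| <= e) ->
  forall a b, `|a - c| < d -> `|b - c| < d ->
    `|g a - g b - A * (a - b)| <= e * `|a - b|.
Proof.
move=> hg he.
have H a b : `|a - c| < d -> `|b - c| < d -> a < b ->
    `|g b - g a - A * (b - a)| <= e * `|b - a|.
  move=> ac bc ab; have inI x : x \in `[a, b] -> `|x - c| < d.
    by rewrite in_itv/=; move: ac bc; rewrite !ltr_distl; lra.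
  have [||x xab ->] := @MVT R g dg a b ab.
  - move=> x xab; apply: hg; apply: inI; move: xab; rewrite !in_itv/=; lra.
  - apply: derivable_within_continuous => x xab.
    by have [] := hg _ (inI _ xab).
  rewrite -mulrBl normrM ler_wpM2r// he// inI//.
  by move: xab; rewrite !in_itv/=; lra.
move=> a b ac bc; have [ab|ba|->] := ltgtP a b.
- have := H _ _ ac bc ab.
  rewrite -normrN (_ : - (g b - g a - A * (b - a)) = g a - g b - A * (a - b)).
    by rewrite (distrC b).
  by ring.
- exact: H.
- by rewrite !subrr mulr0 subrr normr0 mulr0.
Qed.

Lemma boxI p d x y : `|x - p.1| < d -> `|y - p.2| < d -> box p d (x, y).
Proof. by []. Qed.

(** A function with Hoelder continuous partial derivatives is strictly
    differentiable: the mean value theorem is applied along the two coordinate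
    directions. *)
Lemma C1_sdiff eps V f p : open V -> 0 < eps -> C1_holder eps V f -> V p ->
  sdiff f p ('D_e1 f p) ('D_e2 f p).
Proof.
move=> oV eps0 [df h1 h2] Vp e e0.
have [d0 d00 H0] := (open_boxP _).1 oV p Vp.
have /continuous_boxP/(_ _ e0)[d1 d10 H1] := loc_holder_continuous oV eps0 h1 Vp.
have /continuous_boxP/(_ _ e0)[d2 d20 H2] := loc_holder_continuous oV eps0 h2 Vp.
pose d := Num.min d0 (Num.min d1 d2).
have dd0 : d <= d0 by rewrite ge_min lexx.
have dd1 : d <= d1 by rewrite !ge_min lexx orbT.
have dd2 : d <= d2 by rewrite !ge_min lexx !orbT.
exists d; first by rewrite !lt_min d00 d10.
move=> [q1 q2] [r1 r2] [/= hq1 hq2] [/= hr1 hr2].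
have A1 : `|f (q1, q2) - f (r1, q2) - 'D_e1 f p * (q1 - r1)| <= e * `|q1 - r1|.
  apply: (@mvt_approx (fun t => f (t, q2)) (fun t => 'D_e1 f (t, q2)) p.1 d) => //.
  - move=> x hx; apply: derivable_slice1.
    exact: (df _ (H0 (x, q2) (sub_box dd0 (boxI hx hq2)))).1.
  - by move=> x hx; apply: (H1 (x, q2)); exact: (sub_box dd1 (boxI hx hq2)).
have A2 : `|f (r1, q2) - f (r1, r2) - 'D_e2 f p * (q2 - r2)| <= e * `|q2 - r2|.
  apply: (@mvt_approx (fun t => f (r1, t)) (fun t => 'D_e2 f (r1, t)) p.2 d) => //.
  - move=> x hx; apply: derivable_slice2.
    exact: (df _ (H0 (r1, x) (sub_box dd0 (boxI hr1 hx)))).2.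
  - by move=> x hx; apply: (H2 (r1, x)); exact: (sub_box dd2 (boxI hr1 hx)).
rewrite /= (mulrDr e); apply: (le_trans _ (lerD A1 A2)).
apply: (le_trans _ (ler_normD _ _)); rewrite /= le_eqVlt; apply/orP; left; apply/eqP.
by congr `|_|; ring.
Qed.

Lemma continuous_away0 f p : {for p, continuous f} -> f p != 0 ->
  exists2 d, 0 < d & forall q, box p d q -> `|f p| / 2 <= `|f q|.
Proof.
move=> /continuous_boxP cf f0; have x0 : 0 < `|f p| / 2 by rewrite divr_gt0 ?normr_gt0.
have [d d0 hd] := cf _ x0; exists d => // q /hd h.
have := ler_distD (f q) (f p) 0; rewrite !subr0 distrC; lra.
Qed.

(** The injectivity part of the inverse function theorem. *)
Lemma sdiff_local_inj u w p a b a' b' : sdiff u p a b -> sdiff w p a' b' ->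
  a * b' - b * a' != 0 ->
  exists2 d, 0 < d & forall q r, box p d q -> box p d r ->
    (u q, w q) = (u r, w r) -> q = r.
Proof.
move=> su sw J0; set J := _ - _ in J0.
pose M := `|a| + `|b| + `|a'| + `|b'| + 1.
have M0 : 0 < M by rewrite /M ltr_wpDl// !addr_ge0.
have J1 : 0 < `|J| by rewrite normr_gt0.
have e0 : 0 < `|J| / (2 * M) by rewrite divr_gt0// mulr_gt0.
have [d1 d10 h1] := su _ e0; have [d2 d20 h2] := sw _ e0.
exists (Num.min d1 d2); first by rewrite lt_min d10.
move=> q r hq hr [uqr wqr].
have le1 : Num.min d1 d2 <= d1 by rewrite ge_min lexx.
have le2 : Num.min d1 d2 <= d2 by rewrite ge_min lexx orbT.
have := h1 _ _ (sub_box le1 hq) (sub_box le1 hr).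
have := h2 _ _ (sub_box le2 hq) (sub_box le2 hr).
rewrite uqr wqr !subrr !sub0r !normrN.
set x := q.1 - r.1; set y := q.2 - r.2; set S := `|x| + `|y|.
set e := `|J| / (2 * M) => hw hu.
have S0 : 0 <= S by rewrite addr_ge0.
have Hx : `|J| * `|x| <= (`|b'| + `|b|) * (e * S).
  rewrite -normrM (_ : J * x = b' * (a * x + b * y) - b * (a' * x + b' * y)).
    apply: (le_trans (ler_normB _ _)); rewrite !normrM mulrDl.
    by apply: lerD; apply: ler_wpM2l.
  by rewrite /J; ring.
have Hy : `|J| * `|y| <= (`|a| + `|a'|) * (e * S).
  rewrite -normrM (_ : J * y = a * (a' * x + b' * y) - a' * (a * x + b * y)).
    apply: (le_trans (ler_normB _ _)); rewrite !normrM mulrDl.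
    by apply: lerD; apply: ler_wpM2l.
  by rewrite /J; ring.
have eM : M * e = `|J| / 2 by rewrite /e; field; rewrite gt_eqF.
have HS : `|J| * S <= M * (e * S).
  rewrite [in leLHS]/S mulrDr; apply: (le_trans (lerD Hx Hy)).
  rewrite -[leLHS]mulrDl; apply: ler_wpM2r; first by rewrite mulr_ge0// ltW.
  by rewrite /M; lra.
rewrite mulrA eM in HS.
have SZ : S <= 0.
  rewrite -(ler_pM2l J1) mulr0; lra.
have x0 : `|x| = 0 by apply/le_anti; rewrite normr_ge0 andbT (le_trans _ SZ)// lerDl.
have y0 : `|y| = 0 by apply/le_anti; rewrite normr_ge0 andbT (le_trans _ SZ)// lerDr.
move/eqP: x0; rewrite normr_eq0 subr_eq0 => /eqP x0.
move/eqP: y0; rewrite normr_eq0 subr_eq0 => /eqP y0.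
by case: q r x0 y0 {hq hr uqr wqr hw hu x y S S0 Hx Hy HS SZ} => q1 q2 [r1 r2] /= -> ->.
Qed.

End C1.


(** * Preimages of small squares *)

Section Strips.
Context {R : realType}.
Local Notation mR := (measurableTypeR R).
Implicit Types (p q c : R * R) (f u v w rho : R * R -> R) (E G U V Om : set (R * R)).

Lemma open_lt_at f (r : R) G : open G -> (forall p, G p -> {for p, continuous f}) ->
  open [set p | G p /\ `|f p| < r].
Proof.
move=> oG cf; rewrite openE => p [Gp fr].
have nG : nbhs p G by apply: open_nbhs_nbhs.
have cn : (`|f q|) @[q --> p] --> `|f p|.
  by have := cvg_norm (cf _ Gp); apply; exact: nbhs_filter.
have nr : nbhs `|f p| [set x | x < r] by apply: open_nbhs_nbhs; split => //; exact: open_lt.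
have {}nr : nbhs p [set q | `|f q| < r] by exact: cn nr.
by apply: filterS (filterI nG nr).
Qed.

Lemma open_gt_at f (r : R) G : open G -> (forall p, G p -> {for p, continuous f}) ->
  open [set p | G p /\ r < `|f p|].
Proof.
move=> oG cf; rewrite openE => p [Gp fr].
have nG : nbhs p G by apply: open_nbhs_nbhs.
have cn : (`|f q|) @[q --> p] --> `|f p|.
  by have := cvg_norm (cf _ Gp); apply; exact: nbhs_filter.
have nr : nbhs `|f p| [set x | r < x] by apply: open_nbhs_nbhs; split => //; exact: open_gt.
have {}nr : nbhs p [set q | r < `|f q|] by exact: cn nr.
by apply: filterS (filterI nG nr).
Qed.

Lemma sdiff_continuous f p a b : sdiff f p a b -> {for p, continuous f}.
Proof.
move=> /(_ 1 ltr01)[d d0 hd].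
exact: (lin_approx_cont (@box_open _ p d) hd (box_center p d0)).
Qed.

(** The points of [G] where [(u, w)] lies in the open rectangle of centre [(a, b)]
    and half-sides [r], [s]. *)
Definition strip u w G (a b r s : R) : set (R * R) :=
  [set p | (G p /\ `|u p - a| < r) /\ `|w p - b| < s].

Lemma strip_open u w G a b r s : open G ->
  (forall p, G p -> {for p, continuous u}) -> (forall p, G p -> {for p, continuous w}) ->
  open (strip u w G a b r s).
Proof.
move=> oG cu cw; apply: (@open_lt_at (fun p => w p - b)).
  apply: (@open_lt_at (fun p => u p - a)) => // p Gp.
  by apply: cvgB; [exact: cu|exact: cvg_cst].
by move=> p [Gp _]; apply: cvgB; [exact: cw|exact: cvg_cst].
Qed.

(** The area inequality for the preimage of a rectangle. *)
Lemma strip_estimate u w (ux uy wx wy : R * R -> R) G (m a b r s : R) : open G ->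
  (forall p, G p -> sdiff u p (ux p) (uy p)) ->
  (forall p, G p -> sdiff w p (wx p) (wy p)) -> 0 < m ->
  (forall p, G p -> m <= `|ux p * wy p - uy p * wx p|) ->
  (forall p q, G p -> G q -> (u p, w p) = (u q, w q) -> p = q) ->
  0 < r -> 0 < s ->
  (leb2 (strip u w G a b r s) <= (128 / m * (r * s))%:E)%E.
Proof.
move=> oG su sw m0 hJ inj r0 s0; set S := strip _ _ _ _ _ _ _.
have oS : open S.
  by apply: strip_open => // p Gp; apply: sdiff_continuous; [exact: su|exact: sw].
have SG p : S p -> G p by move=> [[]].
have h := @area_inequality R u w ux uy wx wy S m oS (fun p Sp => su p (SG p Sp))
  (fun p Sp => sw p (SG p Sp)) m0 (fun p Sp => hJ p (SG p Sp))
  (fun p q Sp Sq => inj p q (SG p Sp) (SG q Sq)).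
apply: (le_trans h).
have C0 : 0 <= 32 / m by rewrite divr_ge0// ltW.
have mF : measurable ((fun p => (u p, w p)) @` S : set (mR * mR)).
  apply: measurable_image_open => // p /SG Gp.
  by apply: continuous_pair_at; [exact: (sdiff_continuous (su _ Gp))
                                |exact: (sdiff_continuous (sw _ Gp))].
pose Q := [set` `[a - r, a + r]%R] `*` [set` `[b - s, b + s]%R].
apply: (@le_trans _ _ ((32 / m)%:E * leb2 Q)%E).
  apply: lee_wpmul2l; first by rewrite lee_fin.
  apply: leb2_le => //; first by apply: measurableX; exact: measurable_itv.
  by move=> _ [p [[Gp h1] h2] <-]; split; rewrite /= in_itv/= -ler_distl; exact: ltW.
rewrite /Q leb2_rect; [|lra|lra].
by rewrite -EFinM lee_fin le_eqVlt; apply/orP; left; apply/eqP; field; rewrite gt_eqF.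
Qed.

(** The Jacobian determinant of [(u, w)]. *)
Definition jac u w p : R := 'D_e1 u p * 'D_e2 w p - 'D_e2 u p * 'D_e1 w p.

Lemma C1eps_sdiff V u p : open V -> C1eps V u -> V p ->
  sdiff u p ('D_e1 u p) ('D_e2 u p).
Proof. by move=> oV [e e0 hu] Vp; exact: (C1_sdiff oV e0 hu). Qed.

Lemma C1eps_continuous V u p : open V -> C1eps V u -> V p -> {for p, continuous u}.
Proof. by move=> oV hu Vp; exact: (sdiff_continuous (C1eps_sdiff oV hu Vp)). Qed.

Lemma jac_continuous V u w p : open V -> C1eps V u -> C1eps V w -> V p ->
  {for p, continuous (jac u w)}.
Proof.
move=> oV [e e0 [_ hu1 hu2]] [e' e'0 [_ hw1 hw2]] Vp.
apply: cvgB; apply: cvgM.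
- exact: (loc_holder_continuous oV e0 hu1).
- exact: (loc_holder_continuous oV e'0 hw2).
- exact: (loc_holder_continuous oV e0 hu2).
- exact: (loc_holder_continuous oV e'0 hw1).
Qed.

Lemma C1eps_sub U V u : V `<=` U -> C1eps U u -> C1eps V u.
Proof.
move=> VU [e e0 [d h1 h2]]; exists e => //; split.
- by move=> p /VU/d.
- move=> p /VU/h1[W oW [C hC]]; exists W => //; exists C => q q' [Vq Wq] [Vq' Wq'].
  by apply: hC; split => //; exact: VU.
- move=> p /VU/h2[W oW [C hC]]; exists W => //; exists C => q q' [Vq Wq] [Vq' Wq'].
  by apply: hC; split => //; exact: VU.
Qed.

(** Near [p0], the map [(u, v)] sends at most a set of area [C r^tau] of [Om]
    into any square of side of order [r]. *)
Definition small_preimages u v Om (tau : R) p0 : Prop :=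
  exists2 d, 0 < d & exists C : R, forall a b r, 0 < r -> r <= 1 ->
    (leb2 (strip u v (Om `&` box p0 d) a b r r) <= (C * r `^ tau)%:E)%E.

Section Local.
Variables (u v : R * R -> R) (V Om : set (R * R)) (tau : R) (p0 : R * R).
Hypothesis oV : open V.
Hypothesis hu : C1eps V u.
Hypothesis hv : C1eps V v.
Hypothesis oOm : open Om.
Hypothesis inj : forall p q, Om p -> Om q -> (u p, v p) = (u q, v q) -> p = q.
Hypothesis Vp0 : V p0.

Lemma small_preimages_regular : jac u v p0 != 0 -> tau <= 2 ->
  small_preimages u v Om tau p0.
Proof.
move=> J0 tau2.
have [d1 d10 h1] := (open_boxP _).1 oV p0 Vp0.
have [d2 d20 h2] := continuous_away0 (jac_continuous oV hu hv Vp0) J0.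
pose d := Num.min d1 d2.
have dd1 : d <= d1 by rewrite ge_min lexx.
have dd2 : d <= d2 by rewrite ge_min lexx orbT.
exists d; first by rewrite lt_min d10.
have m0 : 0 < `|jac u v p0| / 2 by rewrite divr_gt0 ?normr_gt0.
exists (128 / (`|jac u v p0| / 2)) => a b r r0 r1.
have GV p : (Om `&` box p0 d) p -> V p by move=> [_ /(sub_box dd1)/h1].
apply: (@le_trans _ _ (128 / (`|jac u v p0| / 2) * (r * r))%:E).
  apply: (@strip_estimate u v ('D_e1 u) ('D_e2 u) ('D_e1 v) ('D_e2 v)) => //.
  - by apply: openI => //; exact: box_open.
  - by move=> p /GV; exact: C1eps_sdiff.
  - by move=> p /GV; exact: C1eps_sdiff.
  - by move=> p [_ /(sub_box dd2)/h2].
  - by move=> p q [Op _] [Oq _]; exact: inj.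
rewrite lee_fin ler_wpM2l ?divr_ge0 ?(ltW m0)//.
rewrite -expr2 -powR_mulrn ?(ltW r0)//; apply: ger_powR => //.
by rewrite r0 r1.
Qed.

(** At a point where the Jacobian of [(u, v)] may vanish like [|rho|^s], provided
    that [rho] forms with [u] or with [v] a pair of local coordinates. *)
Lemma small_preimages_degenerate u0 rho U (s c : R) : u0 = u \/ u0 = v ->
  open U -> U p0 -> C1eps U rho -> jac u0 rho p0 != 0 ->
  0 < s -> 0 < c ->
  (forall q, U q -> Om q -> c * `|rho q| `^ s <= `|jac u v q|) ->
  tau <= 2 - s / (s + 1) -> small_preimages u v Om tau p0.
Proof.
move=> u0uv oU Up0 hrho J0 s0 c0 hJ htau.
have hu0 : C1eps V u0 by case: u0uv => ->.
have oUV : open (U `&` V) by exact: openI.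
have hrho' := C1eps_sub (@subIsetl _ U V) hrho.
have hu0' := C1eps_sub (@subIsetr _ U V) hu0.
have UVp0 : (U `&` V) p0 by [].
have [d1 d10 h1] := (open_boxP _).1 oUV p0 UVp0.
have [d2 d20 h2] := continuous_away0 (jac_continuous oUV hu0' hrho' UVp0) J0.
have [d3 d30 h3] := sdiff_local_inj (C1eps_sdiff oUV hu0' UVp0)
  (C1eps_sdiff oUV hrho' UVp0) J0.
pose d := Num.min d1 (Num.min d2 d3).
have dd1 : d <= d1 by rewrite ge_min lexx.
have dd2 : d <= d2 by rewrite !ge_min lexx orbT.
have dd3 : d <= d3 by rewrite !ge_min lexx !orbT.
exists d; first by rewrite !lt_min d10 d20.
have m0 : 0 < `|jac u0 rho p0| / 2 by rewrite divr_gt0 ?normr_gt0.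
pose m := `|jac u0 rho p0| / 2.
exists (256 / m + 128 / c) => a b r r0 r1.
have BU p : box p0 d p -> (U `&` V) p by move=> /(sub_box dd1)/h1.
have BsU p : box p0 d p -> U p by move=> /BU[].
have BsV p : box p0 d p -> V p by move=> /BU[].
(* The cut [|rho| = dl] balances the contribution [r * dl] of the set [A] where
   [rho] is small and the contribution [r^2 / dl^s] of the set [B] where it is
   not. *)
pose dl := r `^ (s + 1)^-1.
have dl0 : 0 < dl by rewrite powR_gt0.
have s1 : s + 1 != 0 by rewrite gt_eqF// ltr_wpDl// ltW.
have [a0 ha0] : exists a0, forall p, strip u v (Om `&` box p0 d) a b r r p ->
    `|u0 p - a0| < r.
  by case: u0uv => ->; [exists a => p [[]]|exists b => p []].
pose A := strip u0 rho (box p0 d) a0 0 r (2 * dl).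
pose G := [set p | (Om `&` box p0 d) p /\ dl < `|rho p|].
have oG : open G.
  apply: open_gt_at; first by apply: openI => //; exact: box_open.
  by move=> p [_ /BU Bp]; exact: (C1eps_continuous oUV hrho').
pose B := strip u v G a b r r.
have oOB : open (Om `&` box p0 d) by apply: openI => //; exact: box_open.
have cu p : box p0 d p -> {for p, continuous u}.
  by move=> /BsV; exact: C1eps_continuous.
have cv p : box p0 d p -> {for p, continuous v}.
  by move=> /BsV; exact: C1eps_continuous.
have mS : measurable (strip u v (Om `&` box p0 d) a b r r : set (mR * mR)).
  by apply: open_measurable2; apply: strip_open => // p [_ Bp]; [exact: cu|exact: cv].
have mA : measurable (A : set (mR * mR)).
  apply: open_measurable2; apply: strip_open; first exact: box_open.
    by move=> p /BU; exact: C1eps_continuous.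
  by move=> p /BU; exact: C1eps_continuous.
have mB : measurable (B : set (mR * mR)).
  by apply: open_measurable2; apply: strip_open => // p [[_ Bp] _]; [exact: cu|exact: cv].
have SAB : strip u v (Om `&` box p0 d) a b r r `<=` A `|` B.
  move=> p Sp; have [[[Op Bp] up] vp] := Sp.
  have [lt|ge] := ltP dl `|rho p|; first by right.
  left; split; first by split => //; exact: ha0.
  by rewrite subr0; apply: (le_lt_trans ge); lra.
have hA : (leb2 A <= (128 / m * (r * (2 * dl)))%:E)%E.
  apply: (@strip_estimate u0 rho ('D_e1 u0) ('D_e2 u0) ('D_e1 rho) ('D_e2 rho)) => //.
  - exact: box_open.
  - by move=> p /BU; exact: C1eps_sdiff.
  - by move=> p /BU; exact: C1eps_sdiff.
  - by move=> p /(sub_box dd2)/h2.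
  - by move=> p q /(sub_box dd3) hp /(sub_box dd3) hq; exact: h3.
  - by rewrite mulr_gt0.
have cdl : 0 < c * dl `^ s by rewrite mulr_gt0// powR_gt0.
have hB : (leb2 B <= (128 / (c * dl `^ s) * (r * r))%:E)%E.
  apply: (@strip_estimate u v ('D_e1 u) ('D_e2 u) ('D_e1 v) ('D_e2 v)) => //.
  - by move=> p [[_ /BsV Bp] _]; exact: (C1eps_sdiff oV).
  - by move=> p [[_ /BsV Bp] _]; exact: (C1eps_sdiff oV).
  - move=> p [[Op Bp] rp]; apply: (le_trans _ (hJ _ (BsU _ Bp) Op)).
    rewrite ler_pM2l//; apply: ge0_ler_powR; rewrite ?nnegrE ?(ltW s0) ?(ltW dl0)//.
    exact: ltW.
  - by move=> p q [[Op _] _] [[Oq _] _]; exact: inj.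
have rn0 : r != 0 by rewrite gt_eqF.
have r0' := ltW r0.
have E1 : r * dl = r `^ (2 - s / (s + 1)).
  rewrite /dl -{1}(powRr1 r0') -powRD; last by rewrite rn0 implybT.
  by congr (_ `^ _); field.
have E2 : r * r / dl `^ s = r `^ (2 - s / (s + 1)).
  apply: (canLR (mulfK _)); first by rewrite gt_eqF// powR_gt0.
  rewrite /dl -powRrM -powRD; last by rewrite rn0 implybT.
  rewrite -expr2 -powR_mulrn//; congr (_ `^ _); field => //.
have rle : r `^ (2 - s / (s + 1)) <= r `^ tau by apply: ger_powR; rewrite ?r0.
apply: (le_trans (leb2_le mS (measurableU _ _ mA mB) SAB)).
apply: (@le_trans _ _ (leb2 A + leb2 B)%E); first exact: measureU2.
apply: (le_trans (leeD hA hB)); rewrite -EFinD lee_fin.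
have -> : 128 / m * (r * (2 * dl)) + 128 / (c * dl `^ s) * (r * r) =
   256 / m * (r * dl) + 128 / c * (r * r / dl `^ s).
  by field; rewrite !gt_eqF// powR_gt0.
have K0 : 0 <= 256 / m + 128 / c.
  apply: addr_ge0; apply: divr_ge0; [exact: ler0n|exact: (ltW m0)|exact: ler0n|exact: (ltW c0)].
rewrite E1 E2 -mulrDl; exact: (ler_wpM2l K0 rle).
Qed.

End Local.
End Strips.


(** * Preimages by the first integral *)

Section Structure.
Context {R : realType}.
Implicit Types (A B Z : R * R -> R[i]) (K Om : set (R * R)).

Local Notation re Z := (fun p => complex.Re (Z p)).
Local Notation im Z := (fun p => complex.Im (Z p)).

(** Up to sign, the function [Im (A * conj B)] is the Jacobian of the first
    integral. *)
Lemma charfun_jac A B Z p : A p = - pderiv e2 Z p -> B p = pderiv e1 Z p ->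
  charfun A B p = - jac (re Z) (im Z) p.
Proof. by rewrite /charfun /jac => -> -> /=; ring. Qed.

Lemma quotient_mono (s t : R) : 0 < s -> s <= t -> s / (s + 1) <= t / (t + 1).
Proof.
move=> s0 st; have t0 : 0 < t by exact: lt_le_trans st.
rewrite ler_pdivrMr ?addr_gt0// mulrAC ler_pdivlMr ?addr_gt0//.
by rewrite !mulrDr !mulr1 (mulrC t s) lerD2l.
Qed.

(** Every point of the closure of [Om] is either noncharacteristic, and then [Z]
    is a local diffeomorphism there, or it lies on a component of the
    characteristic set. In the second case, if the Jacobians of both [(Re Z, rho)]
    and [(Im Z, rho)] vanished, then the real and imaginary parts of the vector
    [(A, B) = (- Z_y, Z_x)] would both be tangent to the curve. *)
Lemma small_preimages_closure Om A B Z (N : nat) (Sg : set (R * R))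
    (Sg_ : 'I_N -> set (R * R)) (sg_ : 'I_N -> R) (tOm V : set (R * R)) :
  open Om ->
  Sg = charset A B (closure Om) -> nontangent A B Sg (closure Om) ->
  range Sg_ = connected_component Sg @` Sg -> (forall j, 0 < sg_ j) ->
  (forall j p, Sg_ j p -> degeneracy_exponent A B tOm Sg (closure Om) p (sg_ j)) ->
  open V -> closure Om `<=` V -> C1eps V (re Z) -> C1eps V (im Z) ->
  (forall p q, Om p -> Om q -> Z p = Z q -> p = q) ->
  (forall p, closure Om p -> A p = - pderiv e2 Z p /\ B p = pderiv e1 Z p) ->
  forall p, closure Om p -> small_preimages (re Z) (im Z) Om
    (2 - (\big[Num.max/0]_(j < N) sg_ j) / ((\big[Num.max/0]_(j < N) sg_ j) + 1)) p.
Proof.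
move=> oOm SgE nt cmp sg0 hexp oV KV hu hv injZ hL p0 Kp0.
set sg := \big[_/_]_(_ < _) _.
have sgge0 : 0 <= sg by exact: bigmax_ge_id.
have inj p q : Om p -> Om q ->
    (re Z p, im Z p) = (re Z q, im Z q) -> p = q.
  move=> Op Oq [e e']; apply: injZ => //.
  by move: e e'; case: (Z p) => a b; case: (Z q) => a' b' /= -> ->.
have [Ap0 Bp0] := hL _ Kp0.
have [ch0|chn0] := eqVneq (charfun A B p0) 0; last first.
  apply: (small_preimages_regular oV) => //; first exact: KV.
    by rewrite -oppr_eq0 -(charfun_jac Ap0 Bp0).
  by rewrite gerBl divr_ge0// addr_ge0.
have Sgp0 : Sg p0 by rewrite SgE.
have [j _ hj] : range Sg_ (connected_component Sg p0) by rewrite cmp; exists p0.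
have := hexp j p0; rewrite hj => /(_ (connected_component_refl Sgp0)).
move=> [U [rho [g [[oU Up0 UtOm] [[hrho rho1 rho2] cg g0 hch]]]]].
have cgp0 : {for p0, continuous g}.
  by move: cg; rewrite continuous_open_subspace// => /(_ p0); apply; rewrite inE.
have /eqP gn0 := g0 _ Up0.
have [d d0 hd] := continuous_away0 cgp0 gn0.
pose U' := U `&` box p0 d.
have oU' : open U' by apply: openI => //; exact: box_open.
have U'p0 : U' p0 by split => //; exact: box_center.
have hrho' : C1eps U' rho by apply: C1eps_sub hrho; exact: subIsetl.
have [u0 u0uv J0] : exists2 u0, u0 = re Z \/ u0 = im Z & jac u0 rho p0 != 0.
  have [Ju|Ju] := eqVneq (jac (re Z) rho p0) 0; last by exists (re Z) => //; left.
  have [Jv|Jv] := eqVneq (jac (im Z) rho p0) 0; last by exists (im Z) => //; right.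
  exfalso; apply: (nt _ Sgp0); split; exists U, rho; split => //=.
    by rewrite Ap0 Bp0 /= -[RHS]Ju /jac; ring.
  by rewrite Ap0 Bp0 /= -[RHS]Jv /jac; ring.
have c0 : 0 < `|g p0| / 2 by rewrite divr_gt0// normr_gt0.
apply: (@small_preimages_degenerate _ (re Z) (im Z) V Om _ p0 oV hu hv oOm inj
  (KV _ Kp0) u0 rho U' (sg_ j) (`|g p0| / 2)) => //.
  move=> q [Uq Bq] Oq; have [Aq Bq'] := hL _ (subset_closure Oq).
  have -> : `|jac (re Z) (im Z) q| = `|charfun A B q|.
    by rewrite (charfun_jac Aq Bq') normrN.
  rewrite hch// normrM mulrC.
  by rewrite ger0_norm ?powR_ge0// ler_wpM2l ?powR_ge0// hd.
by rewrite lerD2l lerN2; apply: quotient_mono => //; exact: le_bigmax.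
Qed.

End Structure.


(** * Compactness and the layer-cake estimate *)

(** Compact sets have every property that is hereditary, stable under finite
    unions and locally true. *)
Lemma compact_ind (T : topologicalType) (K : set T) (good : set T -> Prop) :
  compact K -> good set0 ->
  (forall A B, good A -> good B -> good (A `|` B)) ->
  (forall A B, A `<=` B -> good B -> good A) ->
  (forall p, K p -> exists2 U, nbhs p U & good U) -> good K.
Proof.
move=> cK g0 gU gS gl; apply: contrapT => ngK.
pose F : set_system T := [set B | exists2 A, good A & K `\` A `<=` B].
have FF : ProperFilter F.
  apply: Build_ProperFilter_ex.
    move=> B [A gA KAB]; apply: contrapT => nB; apply: ngK; apply: gS gA => p Kp.
    by apply: contrapT => nAp; apply: nB; exists p; exact: KAB.
  split; first by exists set0.
    move=> B1 B2 [A1 g1 h1] [A2 g2 h2]; exists (A1 `|` A2); first exact: gU.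
    by move=> p [Kp nA]; split; [apply: h1|apply: h2]; split => // Ap; apply: nA;
      [left|right].
  by move=> B1 B2 B12 [A gA h]; exists A => //; exact: subset_trans B12.
have FK : F K by exists set0 => //; exact: subDsetl.
have [p [Kp clp]] := cK F FF FK.
have [U pU gU'] := gl _ Kp.
have FU : F (K `\` U) by exists U.
by have [q [[_ nUq] Uq]] := clp _ _ FU pU.
Qed.

Section Cover.
Context {R : realType}.
Local Notation mR := (measurableTypeR R).
Implicit Types (p q c : R * R) (u v : R * R -> R) (E G U V Om : set (R * R)).

Lemma small_preimages_uniform u v (tau : R) Om V : open V -> open Om ->
  compact (closure Om) -> closure Om `<=` V ->
  (forall p, V p -> {for p, continuous u}) ->
  (forall p, V p -> {for p, continuous v}) ->
  (forall p, closure Om p -> small_preimages u v Om tau p) ->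
  exists2 C : R, 0 <= C & forall a b r, 0 < r -> r <= 1 ->
    (leb2 (strip u v Om a b r r) <= (C * r `^ tau)%:E)%E.
Proof.
move=> oV oOm cK KV cu cv hs.
have OmV : Om `<=` V by move=> p Op; apply: KV; exact: subset_closure.
have mS W a b r : open W -> measurable (strip u v (Om `&` W) a b r r : set (mR * mR)).
  move=> oW; apply: open_measurable2; apply: strip_open; first exact: openI.
    by move=> p [/OmV + _]; exact: cu.
  by move=> p [/OmV + _]; exact: cv.
(* The bound is required on an open set containing [A], so that the sets
   measured are measurable whatever [A] is. *)
pose good (A : set (R * R)) := exists2 W, open W /\ A `<=` W &
  exists2 C : R, 0 <= C & forall a b r, 0 < r -> r <= 1 ->
    (leb2 (strip u v (Om `&` W) a b r r) <= (C * r `^ tau)%:E)%E.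
have [W [oW KW] [C C0 hC]] : good (closure Om).
  apply: compact_ind => //.
  - exists set0; first by split => //; exact: open0.
    exists 0 => // a b r r0 r1; rewrite setI0 mul0r.
    rewrite (_ : strip _ _ _ _ _ _ _ = set0); last first.
      by apply/seteqP; split => // q [[]].
    have -> : leb2 (set0 : set (R * R)) = 0%E by exact: measure0.
    exact: lexx.
  - move=> A1 A2 [W1 [oW1 AW1] [C1 C10 h1]] [W2 [oW2 AW2] [C2 C20 h2]].
    exists (W1 `|` W2); first by split; [exact: openU|exact: setUSS].
    exists (C1 + C2); first exact: addr_ge0.
    move=> a b r r0 r1; rewrite setIUr mulrDl EFinD.
    apply: (le_trans _ (leeD (h1 a b r r0 r1) (h2 a b r r0 r1))).
    rewrite (_ : strip u v (_ `|` _) a b r r =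
      strip u v (Om `&` W1) a b r r `|` strip u v (Om `&` W2) a b r r); last first.
      apply/seteqP; split => q; first by move=> [[[?|?] ?] ?]; [left|right].
      by move=> [[[? ?] ?]|[[? ?] ?]]; split => //; split => //; [left|right].
    by apply: measureU2; exact: mS.
  - by move=> A1 A2 A12 [W [oW AW] hW]; exists W => //; split => //; exact: subset_trans AW.
  - move=> p Kp; have [d d0 [C hC]] := hs _ Kp.
    exists (box p d).
      by apply: open_nbhs_nbhs; split; [exact: box_open|exact: box_center].
    exists (box p d); first by split => //; exact: box_open.
    exists `|C| => // a b r r0 r1; apply: (le_trans (hC a b r r0 r1)).
    by rewrite lee_fin ler_wpM2r ?powR_ge0// ler_norm.
exists C => // a b r r0 r1.
rewrite (_ : Om = Om `&` W); first exact: hC.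
by apply/esym/setIidPl => p Op; apply: KW; exact: subset_closure.
Qed.

End Cover.

Lemma dyadic_weight (R : realType) (C q tau : R) (k : nat) :
  (2 ^+ k.+1) `^ q * (C * (2 ^+ k)^-1 `^ tau) = C * 2 `^ q * (2 `^ (q - tau)) ^+ k.
Proof.
have n2 : (2 : R) != 0 by [].
rewrite mulrCA -mulrA; congr (_ * _).
rewrite -!powR_mulrn ?powR_ge0// -powRN -!powRrM -!powRD ?n2 ?implybT//.
by congr (_ `^ _); rewrite -natr1; ring.
Qed.

Lemma powR2_lt1 (R : realType) (q tau : R) : q < tau -> (2 : R) `^ (q - tau) < 1.
Proof.
move=> qt; have hp : 0 < tau - q by rewrite subr_gt0.
rewrite -(opprB tau q) powRN invf_lt1 ?powR_gt0//.
have e1 : 1 `^ (tau - q) = 1 :> R by rewrite powR1.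
rewrite -[ltLHS]e1; apply: gt0_ltr_powR; rewrite ?nnegrE//.
by rewrite ltr1n.
Qed.

Lemma geometric_partial_sum_le (R : realType) (x : R) n : 0 < x -> x < 1 ->
  \sum_(0 <= k < n) x ^+ k <= (1 - x)^-1.
Proof.
move=> x0 x1; have x1' : 0 < 1 - x by rewrite subr_gt0.
rewrite -[leRHS]div1r ler_pdivlMr// mulr_suml.
have -> : \sum_(0 <= k < n) (x ^+ k * (1 - x)) = 1 - x ^+ n.
  elim: n => [|m IH]; first by rewrite big_nil expr0 subrr.
  by rewrite big_nat_recr//= IH exprS; ring.
by rewrite gerBl exprn_ge0// ltW.
Qed.

Section LayerCake.
Local Open Scope ereal_scope.
Context d (T : measurableType d) (R : realType).
Variable mu : {measure set T -> \bar R}.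
Variables (D : set T) (h : T -> R) (S : nat -> set T) (C q tau : R).
Hypothesis mD : measurable D.
Hypothesis mh : measurable_fun D h.
Hypothesis h0 : forall x, D x -> (0 <= h x)%R.
Hypothesis mS : forall k, measurable (S k).
Hypothesis C0 : (0 <= C)%R.
Hypothesis qtau : (q < tau)%R.
Hypothesis muS : forall k, mu (S k `&` D) <= (C * ((2 ^+ k)^-1 `^ tau))%:E.
Hypothesis hS : forall x, D x ->
  (h x <= 1)%R \/ exists2 k, S k x & (h x <= (2 ^+ k.+1) `^ q)%R.

(** Dyadic layer-cake estimate: if [h] is at most [2^((k+1)q)] on the layer
    [S k], whose measure is of order [2^(-k tau)] with [q < tau], the integral
    of [h] is bounded by a constant that depends on [C], [q] and [tau] only. *)
Lemma dyadic_layer_cake :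
  \int[mu]_(x in D) (h x)%:E <=
    mu D + (C * 2 `^ q / (1 - 2 `^ (q - tau)))%:E.
Proof.
pose c k : R := ((2 ^+ k.+1) `^ q)%R.
have c0 k : (0 <= c k)%R by exact: powR_ge0.
pose g k x : \bar R := (c k)%:E * (\1_(S k) x)%:E.
have g0 k x : 0 <= g k x by rewrite mule_ge0// lee_fin.
have mg k : measurable_fun D (g k).
  by apply: measurable_funeM; apply/measurable_EFinP; exact: measurable_indic.
have le1 : \int[mu]_(x in D) (h x)%:E <=
    \int[mu]_(x in D) (1 + \sum_(0 <= k <oo) g k x).
  apply: ge0_le_integral => //.
  - exact/measurable_EFinP.
  - apply: emeasurable_funD => //; apply: ge0_emeasurable_sum => //.
  move=> x Dx; have [h1|[k Sk hk]] := hS Dx.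
    by apply: (@le_trans _ _ 1); [rewrite lee_fin|rewrite leeDl// nneseries_ge0].
  apply: (@le_trans _ _ (g k x)).
    by rewrite /g indicE mem_set// mule1 lee_fin.
  rewrite -[leLHS]add0e; apply: leeD => //.
  have := @nneseries_lim_ge R (fun i => g i x) xpredT 0 k.+1 (fun i _ _ => g0 i x).
  apply: le_trans; rewrite big_nat_recr//= leeDr//.
  by apply: sume_ge0.
apply: (le_trans le1).
rewrite ge0_integralD//; last 2 first.
- by move=> x _; exact: nneseries_ge0.
- by apply: ge0_emeasurable_sum.
rewrite integral_cst// mul1e; apply: leeD => //.
rewrite integral_nneseries//.
pose x : R := (2 `^ (q - tau))%R.
have x0 : (0 < x)%R by rewrite powR_gt0.
have x1 : (x < 1)%R by exact: powR2_lt1.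
have muk k : \int[mu]_(y in D) g k y <= (C * 2 `^ q * x ^+ k)%:E.
  rewrite /g ge0_integralZl_EFin//; last first.
    by apply/measurable_EFinP; exact: measurable_indic.
  rewrite integral_indic//.
  apply: (@le_trans _ _ ((c k)%:E * (C * ((2 ^+ k)^-1 `^ tau))%:E)).
    by apply: lee_wpmul2l; rewrite ?lee_fin.
  by rewrite -EFinM lee_fin dyadic_weight.
apply: lime_le; first by apply: is_cvg_nneseries => k _ _; exact: integral_ge0.
apply: nearW => n.
apply: (@le_trans _ _ (\sum_(0 <= k < n) (C * 2 `^ q * x ^+ k)%:E)).
  by apply: lee_sum => k _; exact: muk.
rewrite sumEFin lee_fin -mulr_sumr; apply: ler_wpM2l; first by rewrite mulr_ge0// powR_ge0.
exact: geometric_partial_sum_le.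
Qed.

End LayerCake.


(** * Integral operators with uniformly integrable kernels *)

(** The first term of the right-hand side is at least [k] when [k <= a], and the
    second one, which is [k (k / a)^(q - 1)], is at least [k] when [a < k]. *)
Lemma le_affine_powR (R : realType) (k a q : R) : 0 <= k -> 0 < a -> 1 <= q ->
  k <= a + a `^ (1 - q) * k `^ q.
Proof.
move=> k0 a0 q1; have [ka|ak] := leP k a.
  by apply: (le_trans ka); rewrite lerDl mulr_ge0 ?powR_ge0.
have kp : 0 < k by exact: lt_trans ak.
apply: (@le_trans _ _ (a `^ (1 - q) * (k * a `^ (q - 1)))); last first.
  apply: (@le_trans _ _ (a `^ (1 - q) * k `^ q)); last by rewrite lerDr ltW.
  rewrite ler_wpM2l ?powR_ge0//.
  have -> : k `^ q = k * k `^ (q - 1).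
    rewrite -{2}(powRr1 k0) -powRD; last by rewrite (gt_eqF kp) implybT.
    by congr (_ `^ _); ring.
  rewrite ler_wpM2l// ge0_ler_powR ?nnegrE ?subr_ge0//; exact: ltW.
rewrite mulrCA -powRD; last by rewrite (gt_eqF a0) implybT.
by rewrite (_ : 1 - q + (q - 1) = 0) ?powRr0 ?mulr1//; ring.
Qed.

(** The operator with kernel [ker], applied to a density [g >= 0] of mass at most
    [M], when the [q]-th powers of the functions [p |-> ker (z, p)] have integrals
    over [D] bounded by [C] uniformly in the points [z] where [g z <> 0]. *)
Section Schur.
Local Open Scope ereal_scope.
Context d (T : measurableType d) (R : realType).
Variable mu : {sigma_finite_measure set T -> \bar R}.
Variables (D : set T) (g : T -> R) (ker : T * T -> R) (C M q : R).
Hypothesis mD : measurable D.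
Hypothesis muD : mu D < +oo.
Hypothesis mg : measurable_fun setT g.
Hypothesis g0 : forall z, (0 <= g z)%R.
Hypothesis mker : measurable_fun setT ker.
Hypothesis ker0 : forall z, (0 <= ker z)%R.
Hypothesis q1 : (1 <= q)%R.
Hypothesis M0 : (0 <= M)%R.
Hypothesis C0 : (0 <= C)%R.
Hypothesis gM : \int[mu]_z (g z)%:E <= M%:E.
Hypothesis kerC : forall z, g z != 0%R ->
  \int[mu]_(p in D) (ker (z, p) `^ q)%:E <= C%:E.

(** The potential of the density [g] for the [r]-th power of the kernel. *)
Definition potential (r : R) (p : T) := \int[mu]_z (g z * ker (z, p) `^ r)%:E.

Let mker_r (r : R) : measurable_fun setT (fun z : T * T => (g z.1 * ker z `^ r)%:E).
Proof.
apply/measurable_EFinP; apply: measurable_funM.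
  by apply: measurableT_comp => //; exact: measurable_fst.
exact: (measurableT_comp (@measurable_powR R r) mker).
Qed.

Lemma potential_ge0 r p : 0 <= potential r p.
Proof. by apply: integral_ge0 => z _; rewrite lee_fin mulr_ge0// powR_ge0. Qed.

Lemma measurable_potential r : measurable_fun setT (potential r).
Proof.
apply: (@measurable_fun_fubini_tonelli_G _ _ _ _ _ mu
  (fun z : T * T => (g z.1 * ker z `^ r)%:E)) => //.
by move=> z; rewrite lee_fin mulr_ge0// powR_ge0.
Qed.

Lemma integral_potential : \int[mu]_(p in D) potential q p <= (C * M)%:E.
Proof.
have mH : measurable_fun setT
    (fun z : T * T => ((g z.1 * ker z `^ q) * \1_D z.2)%:E).
  apply/measurable_EFinP; apply: measurable_funM; first by apply/measurable_EFinP; exact: mker_r.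
  by apply: measurableT_comp; [exact: measurable_indic|exact: measurable_snd].
have -> : \int[mu]_(p in D) potential q p =
    \int[mu]_p \int[mu]_z ((g z * ker (z, p) `^ q) * \1_D p)%:E.
  rewrite integral_mkcond; apply: eq_integral => p _; rewrite patchE indicE.
  case: (p \in D) => /=.
    by apply: eq_integral => z _; rewrite mulr1.
  by rewrite integral0_eq// => z _; rewrite mulr0.
rewrite -(@fubini_tonelli _ _ _ _ _ mu mu
  (fun z : T * T => ((g z.1 * ker z `^ q) * \1_D z.2)%:E))//=; last first.
  by move=> z; rewrite lee_fin !mulr_ge0// powR_ge0.
apply: (@le_trans _ _ (\int[mu]_z (C * g z)%:E)); last first.
  under eq_integral do rewrite EFinM.
  rewrite ge0_integralZl_EFin//; last 2 first.
  - by move=> z _; rewrite lee_fin.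
  - exact/measurable_EFinP.
  by rewrite EFinM; apply: lee_wpmul2l; rewrite ?lee_fin.
apply: ge0_le_integral => //.
- by move=> z _; apply: integral_ge0 => p _; rewrite lee_fin !mulr_ge0// powR_ge0.
- by apply: (@measurable_fun_fubini_tonelli_F _ _ _ _ _ mu
  (fun z : T * T => ((g z.1 * ker z `^ q) * \1_D z.2)%:E)) => //;
  move=> z; rewrite lee_fin !mulr_ge0// powR_ge0.
- by apply/measurable_EFinP; exact: measurable_funM.
move=> z _; have [gz|gz] := eqVneq (g z) 0%R.
  by rewrite gz mulr0 integral0_eq// => p _; rewrite mul0r mul0r.
have -> : \int[mu]_p (g z * ker (z, p) `^ q * \1_D p)%:E =
    (g z)%:E * \int[mu]_(p in D) (ker (z, p) `^ q)%:E.
  rewrite -ge0_integralZl_EFin//.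
  - rewrite [RHS]integral_mkcond; apply: eq_integral => p _; rewrite patchE indicE.
    case: (p \in D) => /=; first by rewrite mulr1 EFinM.
    by rewrite mulr0.
  - by move=> p _; rewrite lee_fin powR_ge0.
  - apply/measurable_EFinP; apply: measurable_funTS.
    apply: (measurableT_comp (@measurable_powR R q)).
    by apply: (measurableT_comp mker); exact: pair1_measurable.
by rewrite mulrC EFinM; apply: lee_wpmul2l; [rewrite lee_fin|exact: kerC].
Qed.

(** The inequality [le_affine_powR] is integrated with [a] such that
    [a^q = s + 1]; adding [1] avoids the case [s = 0]. *)
Lemma potential1_le p s : (0 <= s)%R -> potential q p = s%:E ->
  potential 1 p <= ((s + 1) `^ q^-1 * (M + 1))%:E.
Proof.
move=> s0 hs; pose a : R := ((s + 1) `^ q^-1)%R.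
have s1 : (0 < s + 1)%R by rewrite ltr_wpDl.
have a0 : (0 < a)%R by rewrite powR_gt0.
have q0 : (q != 0)%R by rewrite gt_eqF// (lt_le_trans _ q1).
apply: (@le_trans _ _ (\int[mu]_z ((a * g z)%:E +
    (a `^ (1 - q))%:E * (g z * ker (z, p) `^ q)%:E))).
  have mk r : measurable_fun setT (fun z => (g z * ker (z, p) `^ r)%:E).
    exact: (measurable_fun_pair1 p (mker_r r)).
  apply: ge0_le_integral => //.
  - by move=> z _; rewrite lee_fin mulr_ge0// powR_ge0.
  - apply: emeasurable_funD; first by apply/measurable_EFinP; exact: measurable_funM.
    exact: measurable_funeM.
  move=> z _; rewrite -EFinM -EFinD lee_fin powRr1//.
  have := le_affine_powR (ker0 (z, p)) a0 q1 => /(ler_wpM2l (g0 z)).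
  by move=> /le_trans; apply; rewrite mulrDr (mulrC a) mulrCA.
have mk r : measurable_fun setT (fun z => (g z * ker (z, p) `^ r)%:E).
  exact: (measurable_fun_pair1 p (mker_r r)).
rewrite ge0_integralD//; last 4 first.
- by move=> z _; rewrite lee_fin mulr_ge0// ltW.
- by apply/measurable_EFinP; exact: measurable_funM.
- by move=> z _; rewrite mule_ge0// lee_fin ?mulr_ge0// powR_ge0.
- exact: measurable_funeM.
rewrite (ge0_integralZl_EFin _ _ _ (mk q)) ?powR_ge0//; last first.
  by move=> z _; rewrite lee_fin mulr_ge0// powR_ge0.
rewrite -/(potential q p) hs mulrDr mulr1 EFinD; apply: leeD.
  under eq_integral do rewrite EFinM.
  rewrite ge0_integralZl_EFin//; last 3 first.
  - by move=> z _; rewrite lee_fin.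
  - exact/measurable_EFinP.
  - exact: ltW.
  by rewrite EFinM; apply: lee_wpmul2l => //; rewrite lee_fin ltW.
rewrite -EFinM lee_fin.
apply: (@le_trans _ _ (a `^ (1 - q) * (s + 1))%R).
  by rewrite ler_wpM2l ?powR_ge0// lerDl.
have e : (s + 1 = a `^ q)%R.
  by rewrite /a -powRrM mulVf// powRr1// ltW.
rewrite [in leLHS]e -powRD; last by rewrite (gt_eqF a0) implybT.
by rewrite subrK powRr1// ltW.
Qed.

Lemma potential1_poweR_le p :
  potential 1 p `^ q <= ((M + 1) `^ q)%:E * (potential q p + 1).
Proof.
have q0 : (0 < q)%R by rewrite (lt_le_trans _ q1).
have M1 : (0 < M + 1)%R by rewrite ltr_wpDl.
have S0 := potential_ge0 q p.
have T0 := potential_ge0 1 p.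
case: (potential q p) (@potential1_le p) S0 => [s hs|_ _|//]; last first.
  by rewrite addye// gt0_muley ?leey// lte_fin powR_gt0.
rewrite lee_fin => s0; have {}hs := hs s s0 erefl.
have s1 : (0 <= s + 1)%R by rewrite addr_ge0.
apply: (@le_trans _ _ ((((s + 1) `^ q^-1 * (M + 1))%R%:E) `^ q)).
  apply: gt0_ler_poweR => //; first exact: ltW.
  - by rewrite in_itv/= T0 leey.
  - by rewrite in_itv/= leey andbT lee_fin mulr_ge0 ?powR_ge0// ltW.
rewrite poweR_EFin -EFinD -EFinM lee_fin powRM ?powR_ge0 ?(ltW M1)//.
by rewrite -powRrM mulVf ?gt_eqF// powRr1// mulrC.
Qed.

Lemma integral_potential1_poweR :
  \int[mu]_(p in D) (potential 1 p `^ q) < +oo.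
Proof.
apply: (@le_lt_trans _ _ (\int[mu]_(p in D)
    (((M + 1) `^ q)%:E * (potential q p + 1)))).
  apply: ge0_le_integral => //.
  - by move=> p _; exact: poweR_ge0.
  - apply: measurable_funTS; apply: (measurableT_comp (measurable_poweR q)).
    exact: measurable_potential.
  - apply: measurable_funTS; apply: measurable_funeM; apply: emeasurable_funD => //.
    exact: measurable_potential.
  - by move=> p _; exact: potential1_poweR_le.
have mp : measurable_fun D (potential q).
  by apply: measurable_funTS; exact: measurable_potential.
rewrite ge0_integralZl_EFin ?powR_ge0//; last 2 first.
- by move=> p _; rewrite adde_ge0// potential_ge0.
- exact: emeasurable_funD.
rewrite ge0_integralD//; last by move=> p _; exact: potential_ge0.
rewrite integral_cst// mul1e; apply: lte_mul_pinfty; rewrite ?lee_fin ?powR_ge0//.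
by apply: lte_add_pinfty => //; apply: (le_lt_trans integral_potential); rewrite ltry.
Qed.

Lemma ae_potential1_lty : {ae mu, forall p, D p -> potential 1 p < +oo}.
Proof.
have : mu.-integrable D (potential q).
  apply/integrableP; split.
    by apply: measurable_funTS; exact: measurable_potential.
  under eq_integral do rewrite gee0_abs ?potential_ge0//.
  by apply: (le_lt_trans integral_potential); rewrite ltry.
move=> /(integrable_ae mD); apply: filterS => p hp Dp.
have S0 := potential_ge0 q p.
have := hp Dp; rewrite ge0_fin_numE// => Sy.
have Sf : potential q p \is a fin_num by rewrite ge0_fin_numE.
apply: le_lt_trans (ltry _); apply: (@potential1_le p (fine (potential q p))).
  exact: fine_ge0.
by rewrite fineK.
Qed.

End Schur.


(** * The kernel of the operator *)

Section Modulus.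
Context {R : realType}.
Implicit Types (x y : R) (z w : R[i]).

(** The modulus of the complex number [x + i y], in terms of real numbers. *)
Definition modulus x y : R := Num.sqrt (x ^+ 2 + y ^+ 2).

Lemma cmodE z : cmod z = modulus (complex.Re z) (complex.Im z).
Proof. by case: z. Qed.

Lemma modulus_ge0 x y : 0 <= modulus x y. Proof. exact: sqrtr_ge0. Qed.

Lemma modulus_sqr x y : modulus x y ^+ 2 = x ^+ 2 + y ^+ 2.
Proof. by rewrite sqr_sqrtr// addr_ge0// sqr_ge0. Qed.

Lemma norm_le_modulus x y : `|x| <= modulus x y /\ `|y| <= modulus x y.
Proof.
by split; rewrite -(@ler_pXn2r _ 2)// ?nnegrE ?modulus_ge0// modulus_sqr
  real_normK ?num_real// ?lerDl ?lerDr sqr_ge0.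
Qed.

Lemma modulus_le_add x y : modulus x y <= `|x| + `|y|.
Proof.
rewrite -(@ler_pXn2r _ 2)// ?nnegrE ?modulus_ge0 ?addr_ge0// modulus_sqr.
rewrite sqrrD !real_normK ?num_real//.
have : 0 <= `|x| * `|y| by rewrite mulr_ge0.
by lra.
Qed.

Lemma modulus_distC (a b c d : R) : modulus (a - b) (c - d) = modulus (b - a) (d - c).
Proof. by rewrite /modulus -(sqrrN (a - b)) -(sqrrN (c - d)) !opprB. Qed.

Lemma cmodM z w : cmod (z * w) = cmod z * cmod w.
Proof. exact: ComplexField.Normc.normcM. Qed.

Lemma cmodV z : cmod z^-1 = (cmod z)^-1.
Proof.
have [->|z0] := eqVneq z 0; first by rewrite invr0 cmodE /modulus/= expr0n/= addr0 sqrtr0 invr0.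
have c1 : cmod (1 : R[i]) = 1 by rewrite cmodE /modulus/= expr1n expr0n/= addr0 sqrtr1.
have : cmod z * cmod z^-1 = 1 by rewrite -cmodM mulfV.
move=> e; have cz0 : cmod z != 0 by apply: contra_eq_neq e => ->; rewrite mul0r eq_sym oner_neq0.
by apply: (mulfI cz0); rewrite e mulfV.
Qed.

Lemma re_div z w : complex.Re (z / w) =
  (complex.Re z * complex.Re w + complex.Im z * complex.Im w) * (cmod w)^-1 ^+ 2.
Proof.
by rewrite cmodE exprVn modulus_sqr; case: z w => a b [c d] /=; ring.
Qed.

Lemma im_div z w : complex.Im (z / w) =
  (complex.Im z * complex.Re w - complex.Re z * complex.Im w) * (cmod w)^-1 ^+ 2.
Proof.
by rewrite cmodE exprVn modulus_sqr; case: z w => a b [c d] /=; ring.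
Qed.

Lemma re_im_div_le z w : `|complex.Re (z / w)| <= cmod z * (cmod w)^-1 /\
  `|complex.Im (z / w)| <= cmod z * (cmod w)^-1.
Proof. by rewrite -cmodV -cmodM cmodE; exact: norm_le_modulus. Qed.

End Modulus.

Section KernelIntegral.
Context {R : realType}.
Local Notation mR := (measurableTypeR R).
Implicit Types (p q : R * R) (u v : R * R -> R) (V Om : set (R * R)).

Lemma open_continuous_measurable2 (f : R * R -> R) Om : open Om ->
  (forall p, Om p -> {for p, continuous f}) ->
  measurable_fun (Om : set (mR * mR)) f.
Proof.
move=> oO cf; apply: (measurability _ (RGenOpens.measurableE R)).
move=> _ [_ [a [b ->] <-]]; apply: open_measurable2.
rewrite openE => p [Op fp].
have nO : nbhs p Om by apply: open_nbhs_nbhs.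
have nf : nbhs (f p) [set` `]a, b[%R].
  by apply: open_nbhs_nbhs; split => //; exact: interval_open.
by have nr := cf _ Op _ nf; apply: filterS (filterI nO nr).
Qed.

Lemma measurable_modulus d (T : measurableType d) (D : set T) (x y : T -> R) :
  measurable_fun D x -> measurable_fun D y ->
  measurable_fun D (fun t => modulus (x t) (y t)).
Proof.
move=> mx my.
have ms : measurable_fun [set: R] (@Num.sqrt R).
  by apply: continuous_measurable_fun; exact: sqrt_continuous.
have mxy : measurable_fun D (fun t => x t ^+ 2 + y t ^+ 2).
  by apply: measurable_funD; exact: measurable_funX.
exact: (measurableT_comp ms mxy).
Qed.

Lemma measurable_inv_ge0 d (T : measurableType d) (D : set T) (x : T -> R) :
  (forall t, 0 <= x t) -> measurable_fun D x -> measurable_fun D (fun t => (x t)^-1).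
Proof.
move=> x0 mx; rewrite (_ : (fun _ => _) = (fun t => x t `^ (-1))).
  exact: (measurableT_comp (@measurable_powR R (-1)) mx).
by apply/funext => t; rewrite powR_inv1.
Qed.

(** If [s < 1], the index [k] is such that [2^(- k - 1) <= s < 2^(- k)]; for
    [s = 0] the convention [0^-1 = 0] is used. *)
Lemma dyadic_layer (s q : R) : 0 <= s -> 1 <= q ->
  s^-1 `^ q <= 1 \/ exists2 k, s < (2 ^+ k)^-1 & s^-1 `^ q <= (2 ^+ k.+1) `^ q.
Proof.
move=> s0 q1; have q0 : 0 < q by exact: lt_le_trans q1.
have [->|sn0] := eqVneq s 0.
  by left; rewrite invr0 powR0 ?gt_eqF.
have sp : 0 < s by rewrite lt_neqAle eq_sym sn0.
have [s1|s1] := leP 1 s.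
  left; rewrite -(powRr0 s^-1); apply: ger_powR; last exact: ltW.
  by rewrite invr_gt0 sp invf_le1.
right; have ex : exists n, (2 ^+ n)^-1 <= s.
  have M0 : 0 <= s^-1 by rewrite invr_ge0.
  have /andP[_ hM] := truncn_itv M0.
  exists (Num.truncn s^-1).+1; rewrite invf_ple ?posrE ?exprn_gt0//.
  by apply: ltW; apply: (lt_trans hM); rewrite -natrX ltr_nat ltn_expl.
case: (ex_minnP ex) => -[|k] hn hmin.
  by move: hn; rewrite expr0 invr1 leNgt s1.
exists k; first by rewrite ltNge; apply/negP => /hmin; rewrite ltnn.
apply: ge0_ler_powR; rewrite ?nnegrE ?invr_ge0 ?exprn_ge0 ?(ltW q0)//.
by rewrite invf_ple ?posrE ?exprn_gt0.
Qed.

(** The integrals of [|Z(p) - z0|^(-q)] over [Om] are bounded uniformly in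
    [z0 = a + i b], when the preimages of squares of side of order [r] have
    measure at most [C r^tau] with [q < tau]. *)
Lemma kernel_integral_le u v Om (tau C q : R) : open Om ->
  (forall p, Om p -> {for p, continuous u}) ->
  (forall p, Om p -> {for p, continuous v}) ->
  (leb2 Om < +oo)%E -> 0 <= C -> 1 <= q -> q < tau ->
  (forall a b r, 0 < r -> r <= 1 ->
    (leb2 (strip u v Om a b r r) <= (C * r `^ tau)%:E)%E) ->
  exists2 C', 0 <= C' & forall a b,
    (\int[leb2]_(p in (Om : set (mR * mR)))
        ((modulus (u p - a) (v p - b))^-1 `^ q)%:E <= C'%:E)%E.
Proof.
move=> oOm cu cv Omoo C0 q1 qtau hC.
have mOm := open_measurable2 oOm.
have L0 : (0 <= leb2 Om)%E by exact: leb2_ge0.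
have x1 := powR2_lt1 qtau.
exists (fine (leb2 Om) + C * 2 `^ q / (1 - 2 `^ (q - tau))).
  rewrite addr_ge0 ?fine_ge0// divr_ge0 ?mulr_ge0 ?powR_ge0// subr_ge0; exact: ltW.
move=> a b; rewrite EFinD fineK; last by rewrite ge0_fin_numE.
have r0 k : 0 < (2 ^+ k)^-1 :> R by rewrite invr_gt0 exprn_gt0.
have mu := open_continuous_measurable2 oOm cu.
have mv := open_continuous_measurable2 oOm cv.
apply: (@dyadic_layer_cake _ _ _ _ (Om : set (mR * mR)) _
  (fun k => strip u v Om a b (2 ^+ k)^-1 (2 ^+ k)^-1)) => //.
- apply: (measurableT_comp (@measurable_powR R q)).
  apply: measurable_inv_ge0; first by move=> t; exact: modulus_ge0.
  by apply: measurable_modulus; apply: measurable_funB => //; exact: measurable_cst.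
- by move=> p _; exact: powR_ge0.
- by move=> k; apply: open_measurable2; exact: strip_open.
- move=> k; rewrite setIidl; last by move=> p [[]].
  by apply: hC => //; rewrite invf_le1 ?exprn_gt0// exprn_ege1// ler1n.
- move=> p Op; have [h|[k hk hk']] := dyadic_layer (modulus_ge0 (u p - a) (v p - b)) q1.
    by left.
  right; exists k => //; have [n1 n2] := norm_le_modulus (u p - a) (v p - b).
  by split; [split => //; exact: le_lt_trans hk|exact: le_lt_trans hk].
Qed.

HB.instance Definition _ := Measure.on (@leb2 R).
Lemma leb2_sigma_finite : sigma_finite setT (@leb2 R).
Proof.
exists (fun n => cbox (0, 0) n%:R).
  apply/esym/seteqP; split => // p _.
  have M0 : 0 <= `|p| by [].
  have /andP[_ hM] := truncn_itv M0.
  exists (Num.truncn `|p|).+1 => //.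
  have : `|p| <= (Num.truncn `|p|).+1%:R by exact: ltW.
  by rewrite /cbox/= !subr0 [X in X <= _]prod_normE ge_max => /andP[].
by move=> n; split; [exact: measurable_cbox|rewrite leb2_cbox// ltry].
Qed.
HB.instance Definition _ :=
  Measure_isSigmaFinite.Build _ _ _ (@leb2 R) leb2_sigma_finite.

End KernelIntegral.


(** * Integrability of the kernel and of its integral *)

(** The operator is studied through real functions that are measurable on the
    whole plane: the real and imaginary parts of [Z] and [f], extended by [0]
    outside [Om]. *)
Section TZ.
Context {R : realType}.
Local Notation mR := (measurableTypeR R).
Local Notation T := (mR * mR)%type.
Local Notation mu := (@leb2 R).
Local Notation re Z := (fun p => complex.Re (Z p)).
Local Notation im Z := (fun p => complex.Im (Z p)).

Variables (Om : set (R * R)) (Z f : R * R -> R[i]) (C q : R).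
Hypothesis mOm : measurable (Om : set T).
Hypothesis Omoo : (leb2 Om < +oo)%E.
Hypothesis mre : measurable_fun (Om : set T) (re Z).
Hypothesis mim : measurable_fun (Om : set T) (im Z).
Hypothesis f_L1 : Lq Om 1 f.
Hypothesis q1 : 1 <= q.
Hypothesis C0 : 0 <= C.
Hypothesis kerC : forall a b,
  (\int[leb2]_(p in (Om : set T))
     ((modulus (complex.Re (Z p) - a) (complex.Im (Z p) - b))^-1 `^ q)%:E <= C%:E)%E.

Let u : T -> R := (re Z : T -> R) \_ Om.
Let v : T -> R := (im Z : T -> R) \_ Om.
Let f1 : T -> R := (re f : T -> R) \_ Om.
Let f2 : T -> R := (im f : T -> R) \_ Om.

Let mu0 : measurable_fun setT u.
Proof. by apply/(measurable_restrictT _ mOm). Qed.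
Let mv0 : measurable_fun setT v.
Proof. by apply/(measurable_restrictT _ mOm). Qed.
Let mf1 : measurable_fun setT f1.
Proof. by apply/(measurable_restrictT _ mOm); have [] := f_L1. Qed.
Let mf2 : measurable_fun setT f2.
Proof. by apply/(measurable_restrictT _ mOm); have [] := f_L1. Qed.

Let uE z : Om z -> u z = complex.Re (Z z).
Proof. by move=> Oz; rewrite /u patchE mem_set. Qed.
Let vE z : Om z -> v z = complex.Im (Z z).
Proof. by move=> Oz; rewrite /v patchE mem_set. Qed.
Let f1E z : Om z -> f1 z = complex.Re (f z).
Proof. by move=> Oz; rewrite /f1 patchE mem_set. Qed.
Let f2E z : Om z -> f2 z = complex.Im (f z).
Proof. by move=> Oz; rewrite /f2 patchE mem_set. Qed.
Let f1_out z : ~ Om z -> f1 z = 0.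
Proof. by move=> Oz; rewrite /f1 patchE memNset. Qed.
Let f2_out z : ~ Om z -> f2 z = 0.
Proof. by move=> Oz; rewrite /f2 patchE memNset. Qed.

(* [g] is the modulus of [f] on [Om]; at points [(z, p)] of [Om * Om], [ker] is
   [1 / |Z z - Z p|], and [h1], [h2] are the real and imaginary parts of
   [f z / (Z z - Z p)]. *)
Let g (z : T) : R := modulus (f1 z) (f2 z).
Let X (z : T * T) : R := u z.1 - u z.2.
Let Y (z : T * T) : R := v z.1 - v z.2.
Let ker (z : T * T) : R := (modulus (X z) (Y z))^-1.
Let h1 (z : T * T) : R := (f1 z.1 * X z + f2 z.1 * Y z) * ker z ^+ 2.
Let h2 (z : T * T) : R := (f2 z.1 * X z - f1 z.1 * Y z) * ker z ^+ 2.

Let g0 z : 0 <= g z. Proof. exact: modulus_ge0. Qed.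
Let ker0 z : 0 <= ker z. Proof. by rewrite invr_ge0 modulus_ge0. Qed.
Let mg : measurable_fun setT g. Proof. exact: measurable_modulus. Qed.

Let mfst (k : T -> R) : measurable_fun setT k -> measurable_fun setT (fun z : T * T => k z.1).
Proof. by move=> mk; apply: measurableT_comp => //; exact: measurable_fst. Qed.
Let msnd (k : T -> R) : measurable_fun setT k -> measurable_fun setT (fun z : T * T => k z.2).
Proof. by move=> mk; apply: measurableT_comp => //; exact: measurable_snd. Qed.
Let mX : measurable_fun setT X.
Proof.
by apply: measurable_funB; [exact: mfst|exact: msnd].
Qed.
Let mY : measurable_fun setT Y.
Proof.
by apply: measurable_funB; [exact: mfst|exact: msnd].
Qed.
Let mker : measurable_fun setT ker.
Proof.
apply: measurable_inv_ge0; first by move=> t; exact: modulus_ge0.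
exact: measurable_modulus.
Qed.
Let mh1 : measurable_fun setT h1.
Proof.
apply: measurable_funM; last exact: measurable_funX.
by apply: measurable_funD; apply: measurable_funM => //; exact: mfst.
Qed.
Let mh2 : measurable_fun setT h2.
Proof.
apply: measurable_funM; last exact: measurable_funX.
by apply: measurable_funB; apply: measurable_funM => //; exact: mfst.
Qed.

Let cmod_kerE z p : Om z -> Om p -> (cmod (Z z - Z p))^-1 = ker (z, p).
Proof.
move=> Oz Op; rewrite /ker /X /Y /= !uE// !vE// cmodE.
by case: (Z z) => a b; case: (Z p).
Qed.

Let kerE1 z p : Om z -> Om p -> complex.Re (TZ_kernel Z f p z) = h1 (z, p).
Proof.
move=> Oz Op; rewrite /TZ_kernel re_div (cmod_kerE Oz Op) /h1 /X /Y /= !uE// !vE// f1E// f2E//.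
by case: (Z z) => a b; case: (Z p).
Qed.

Let kerE2 z p : Om z -> Om p -> complex.Im (TZ_kernel Z f p z) = h2 (z, p).
Proof.
move=> Oz Op; rewrite /TZ_kernel im_div (cmod_kerE Oz Op) /h2 /X /Y /= !uE// !vE// f1E// f2E//.
by case: (Z z) => a b; case: (Z p).
Qed.

Let h1_out z p : ~ Om z -> h1 (z, p) = 0.
Proof. by move=> Oz; rewrite /h1 /= f1_out// f2_out// !mul0r addr0 mul0r. Qed.
Let h2_out z p : ~ Om z -> h2 (z, p) = 0.
Proof. by move=> Oz; rewrite /h2 /= f1_out// f2_out// !mul0r subr0 mul0r. Qed.

Let h_le z p : Om p -> `|h1 (z, p)| <= g z * ker (z, p) /\ `|h2 (z, p)| <= g z * ker (z, p).
Proof.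
move=> Op; have [Oz|Oz] := pselect (Om z); last first.
  by rewrite h1_out// h2_out// normr0 mulr_ge0.
rewrite -kerE1// -kerE2// -cmod_kerE// /g f1E// f2E// -cmodE.
exact: re_im_div_le.
Qed.

Let M : R := fine (\int[leb2]_z (g z)%:E)%E.

Let gM : (\int[leb2]_z (g z)%:E <= M%:E)%E.
Proof.
have [_ _] := f_L1; rewrite Lnorm1 => h.
have e : (\int[leb2]_x `|(((fun p : T => (cmod (f p))%:E) \_ Om) x)| =
    \int[leb2]_z (g z)%:E)%E.
  apply: eq_integral => z _; rewrite patchE /g.
  have [Oz|Oz] := pselect (Om z).
    by rewrite mem_set// cmodE f1E// f2E// gee0_abs// lee_fin modulus_ge0.
  by rewrite memNset// f1_out// f2_out// abse0 /modulus expr0n/= addr0 sqrtr0.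
rewrite /M fineK// ge0_fin_numE -?e//.
by apply: integral_ge0 => z _; exact: abse_ge0.
Qed.

Let M0 : 0 <= M.
Proof. by apply: fine_ge0; apply: integral_ge0 => z _; rewrite lee_fin. Qed.

Let kerC' z : g z != 0 ->
  (\int[mu]_(p in Om) (ker (z, p) `^ q)%:E <= C%:E)%E.
Proof.
move=> gz; have Oz : Om z.
  apply: contrapT => Oz; move: gz.
  by rewrite /g f1_out// f2_out// /modulus expr0n/= addr0 sqrtr0 eqxx.
apply: le_trans (kerC (complex.Re (Z z)) (complex.Im (Z z))).
rewrite le_eqVlt; apply/orP; left; apply/eqP; apply: eq_integral => p.
by rewrite inE => Op; rewrite /ker /X /Y /= !uE// !vE// modulus_distC.
Qed.

Let P : T -> \bar R := @potential _ T R mu g ker 1.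

Let PE p : P p = (\int[leb2]_z (g z * ker (z, p))%:E)%E.
Proof. by apply: eq_integral => z _; rewrite powRr1. Qed.

Let mh_p (h : T * T -> R) p : measurable_fun setT h ->
  measurable_fun [set: T] (fun z => (h (z, p))%:E).
Proof. by move=> mh; apply/measurable_EFinP; exact: measurable_fun_pair1. Qed.

Let mgk p : measurable_fun [set: T] (fun z => (g z * ker (z, p))%:E).
Proof.
apply/measurable_EFinP; apply: measurable_funM => //.
exact: measurable_fun_pair1.
Qed.

Let int_le_P (h : T * T -> R) p : measurable_fun setT h ->
  (forall z, `|h (z, p)| <= g z * ker (z, p)) ->
  (\int[leb2]_(z in (Om : set T)) `|(h (z, p))%:E| <= P p)%E.
Proof.
move=> mh hle; rewrite PE.
have mk := mgk p; have mhp := mh_p p mh.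
have mah : measurable_fun [set: T] (fun z => `|(h (z, p))%:E|%E) by exact: measurableT_comp.
apply: (@le_trans _ _ (\int[leb2]_z `|(h (z, p))%:E|)%E).
  by apply: ge0_subset_integral => //; exact: measurableT.
apply: ge0_le_integral => //.
by move=> z _; rewrite lee_fin hle.
Qed.

Lemma ae_cintegrable_TZ_kernel :
  {ae leb2, forall p, Om p -> cintegrable Om (TZ_kernel Z f p)}.
Proof.
have := @ae_potential1_lty _ T R mu (Om : set T) g ker C M q
  mOm mg g0 mker ker0 q1 C0 gM kerC'.
apply: filterS => p + Op => /(_ Op) hP.
split; apply/integrableP; split.
- apply: (eq_measurable_fun (fun z => (h1 (z, p))%:E)).
    by move=> z; rewrite inE => Oz; rewrite kerE1.
  by apply: measurable_funTS; exact: mh_p.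
- apply: le_lt_trans hP; apply: le_trans (int_le_P mh1 (fun z => (h_le z Op).1)).
  rewrite le_eqVlt; apply/orP; left; apply/eqP; apply: eq_integral => z.
  by rewrite inE => Oz; rewrite kerE1.
- apply: (eq_measurable_fun (fun z => (h2 (z, p))%:E)).
    by move=> z; rewrite inE => Oz; rewrite kerE2.
  by apply: measurable_funTS; exact: mh_p.
- apply: le_lt_trans hP; apply: le_trans (int_le_P mh2 (fun z => (h_le z Op).2)).
  rewrite le_eqVlt; apply/orP; left; apply/eqP; apply: eq_integral => z.
  by rewrite inE => Oz; rewrite kerE2.
Qed.

(* The components of the integral of the kernel; the value of [fine] at an
   infinite or undefined integral is irrelevant for the bounds below. *)
Let I (h : T * T -> R) (p : T) : R := fine (\int[leb2]_(z in (Om : set T)) (h (z, p))%:E)%E.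

Let measurable_I (h : T * T -> R) : measurable_fun setT h ->
  (forall z p : T, ~ Om z -> h (z, p) = 0) ->
  measurable_fun [set: T] (I h).
Proof.
move=> mh hout.
have -> : I h = (fun p => fine ((\int[mu]_z ((EFin \o h)^\+ (z, p))) -
    (\int[mu]_z ((EFin \o h)^\- (z, p))))%E).
  apply/funext => p; rewrite /I; congr fine.
  transitivity (\int[mu]_z (h (z, p))%:E)%E; last first.
    rewrite integralE; congr (_ - _)%E; apply: eq_integral => z _.
      by rewrite !funeposE.
    by rewrite !funenegE.
  rewrite integral_mkcond; apply: eq_integral => z _.
  rewrite patchE; case: ifPn => //; rewrite notin_setE => Oz.
  by rewrite hout.
have mE : measurable_fun setT (EFin \o h) by exact/measurable_EFinP.
apply: (measurableT_comp (f := fine)); first exact: fine_measurable.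
apply: emeasurable_funB.
  by apply: (@measurable_fun_fubini_tonelli_G _ _ _ _ _ mu ((EFin \o h)^\+)%E) => //;
    exact: measurable_funepos.
by apply: (@measurable_fun_fubini_tonelli_G _ _ _ _ _ mu ((EFin \o h)^\-)%E) => //;
  exact: measurable_funeneg.
Qed.

Let I_le (h : T * T -> R) (p : T) : measurable_fun setT h ->
  (forall z, `|h (z, p)| <= g z * ker (z, p)) ->
  ((`|I h p|)%:E <= P p)%E.
Proof.
move=> mh hle; have fle (x : \bar R) : ((`|fine x|)%:E <= `|x|)%E.
  by case: x => [x| |]//=; rewrite normr0 leey.
apply: (le_trans (fle _)); apply: le_trans (int_le_P mh hle).
by apply: le_abse_integral => //; apply: measurable_funTS; exact: mh_p.
Qed.

Let TZE p : Om p -> TZ Om Z f p = (2 * pi%:C * 'i)^-1 * (I h1 p +i* I h2 p).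
Proof.
move=> Op; rewrite /TZ /cintegral /Rintegral; congr (_ * (fine _ +i* fine _)).
  by apply: eq_integral => z; rewrite inE => Oz; rewrite kerE1.
by apply: eq_integral => z; rewrite inE => Oz; rewrite kerE2.
Qed.

Let two_pi_i : 2 * pi%:C * 'i = 0 +i* (2 * pi) :> R[i].
Proof.
by apply/eqP; rewrite eq_complex /=; apply/andP; split; apply/eqP; ring.
Qed.

Let TZ_reim p : Om p -> complex.Re (TZ Om Z f p) = (2 * pi)^-1 * I h2 p /\
  complex.Im (TZ Om Z f p) = - ((2 * pi)^-1 * I h1 p).
Proof.
have p0 := pi_gt0 R; have pn0 : pi != 0 :> R by rewrite gt_eqF.
move=> Op; rewrite TZE// two_pi_i mulrC.
rewrite re_div im_div exprVn cmodE modulus_sqr /=.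
rewrite expr0n !mulr0 !add0r mulNr.
have E (x a : R) : a != 0 -> x * a / a ^+ 2 = a^-1 * x by move=> a0; field.
by rewrite !E// mulf_neq0.
Qed.

Let TZ_le p : Om p -> ((cmod (TZ Om Z f p))%:E <= P p)%E.
Proof.
move=> Op; have [eR eI] := TZ_reim Op.
have p0 := pi_gt0 R; have p2 : 2 <= pi :> R by exact: pi_ge2.
have P0 : (0 <= P p)%E by exact: (@potential_ge0 _ T R mu g ker g0 1).
have l1 := I_le mh1 (fun z => (h_le z Op).1).
have l2 := I_le mh2 (fun z => (h_le z Op).2).
case: (P p) P0 l1 l2 => [s| |]; [|by move=> _ _ _; exact: leey|by []].
rewrite !lee_fin => s0 l1 l2; rewrite cmodE eR eI.
apply: (le_trans (modulus_le_add _ _)).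
have w0 : 0 < (2 * pi)^-1 :> R by rewrite invr_gt0 mulr_gt0.
rewrite normrN !normrM -mulrDr (gtr0_norm w0) ler_pdivrMl ?mulr_gt0//.
apply: (le_trans (lerD l2 l1)).
have : 2 * s <= pi * s by rewrite ler_wpM2r.
have : 0 <= pi * s by rewrite mulr_ge0// ltW.
by lra.
Qed.

Lemma TZ_Lq : Lq Om q (TZ Om Z f).
Proof.
have mI1 := measurable_I mh1 (fun z p Oz => h1_out p Oz).
have mI2 := measurable_I mh2 (fun z p Oz => h2_out p Oz).
have mR1 : measurable_fun (Om : set T) (re (TZ Om Z f)).
  apply: (eq_measurable_fun (fun p => (2 * pi)^-1 * I h2 p)).
    by move=> p; rewrite inE => Op; rewrite (TZ_reim Op).1.
  by apply: measurable_funTS; apply: measurable_funM.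
have mR2 : measurable_fun (Om : set T) (im (TZ Om Z f)).
  apply: (eq_measurable_fun (fun p => - ((2 * pi)^-1 * I h1 p))).
    by move=> p; rewrite inE => Op; rewrite (TZ_reim Op).2.
  by apply: measurable_funTS; apply: measurable_funN; apply: measurable_funM.
split => //.
rewrite unlock; apply: poweR_lty.
have mP : measurable_fun [set: T] P.
  exact: (@measurable_potential _ T R mu g ker mg g0 mker).
have mcm : measurable_fun (Om : set T) (fun p => cmod (TZ Om Z f p)).
  rewrite (_ : (fun _ => _) = fun p =>
    modulus (complex.Re (TZ Om Z f p)) (complex.Im (TZ Om Z f p))).
    exact: measurable_modulus.
  by apply/funext => p; rewrite cmodE.
have q0 : 0 < q by exact: lt_le_trans q1.
have fin := @integral_potential1_poweR _ T R mu (Om : set T) g ker C M q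
  mOm Omoo mg g0 mker ker0 q1 M0 C0 gM kerC'.
apply: le_lt_trans fin; rewrite [leRHS]integral_mkcond.
have mr : measurable_fun [set: T] ((fun p : T => (cmod (TZ Om Z f p))%:E) \_ Om).
  by apply/(measurable_restrictT _ mOm); exact/measurable_EFinP.
have itv0 (x : \bar R) : (0 <= x)%E -> x \in `[0%E, +oo%E].
  by move=> x0; rewrite in_itv/= x0 leey.
apply: ge0_le_integral => //.
- by move=> p _; exact: poweR_ge0.
- apply: (measurableT_comp (measurable_poweR q)).
  exact: measurableT_comp.
- apply/(measurable_restrictT _ mOm); apply: measurable_funTS.
  exact: (measurableT_comp (measurable_poweR q)).
- move=> p _; rewrite !patchE; case: ifPn => [|_].
    rewrite inE => Op; rewrite gee0_abs; last by rewrite lee_fin cmodE modulus_ge0.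
    apply: gt0_ler_poweR; rewrite ?(ltW q0)//.
    + by apply: itv0; rewrite lee_fin cmodE modulus_ge0.
    + by apply: itv0; exact: (@potential_ge0 _ T R mu g ker g0 1).
    + exact: TZ_le.
  by rewrite abse0 poweR0r// gt_eqF.
Qed.

End TZ.

Unset Implicit Arguments.
Set Strict Implicit.
Set Printing Implicit Defensive.

Theorem proposition10 (R : realType)
    (tOmega Omega : set (R * R)) (A B : R * R -> R[i])
    (* the vector field L = A d/dx + B d/dy on tOmega, and the domain Omega *)
    (tOmega_open : open tOmega)
    (A_holder : holder_cplx tOmega A)
    (B_holder : holder_cplx tOmega B)
    (AB_neq0 : forall p, tOmega p -> 0 < cmod (A p) + cmod (B p))
    (Omega_open : open Omega)
    (Omega_relcompact : compact (closure Omega))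
    (Omega_sub : closure Omega `<=` tOmega)
    (Omega_bnd : piecewise_C1 (closure Omega `\` interior Omega))
    (* (i) *)
    (L_hypocomplex : forall p, closure Omega p -> hypocomplex_at A B tOmega p)
    (* (ii) *)
    (Sigma : set (R * R))
    (Sigma_def : Sigma = charset A B (closure Omega))
    (Sigma_curve : C1eps_curve Sigma (closure Omega))
    (Sigma_nontangent : nontangent A B Sigma (closure Omega))
    (* (iii), with constant exponents on the components of Sigma *)
    (N : nat) (Sigma_ : 'I_N -> set (R * R)) (sigma_ : 'I_N -> R)
    (Sigma_inj : injective Sigma_)
    (Sigma_components :
       range Sigma_ = connected_component Sigma @` Sigma)
    (sigma_gt0 : forall j, 0 < sigma_ j)
    (Sigma_exponent : forall j p, Sigma_ j p ->
       degeneracy_exponent A B tOmega Sigma (closure Omega) p (sigma_ j))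
    (sigma : R)
    (sigma_max : sigma = \big[Num.max/0]_(j < N) sigma_ j)
    (* the global first integral *)
    (Z : R * R -> R[i])
    (Z_C1eps : C1eps_cplx_closed (closure Omega) Z)
    (Z_homeo : homeo_onto_image (closure Omega) (Z : R * R -> R[i]^o))
    (LZ_eq0 : forall p, closure Omega p -> vf_apply A B Z p = 0)
    (Z_dZ_neq0 : forall p, closure Omega p -> dZ_neq0 Z p)
    (L_eq : forall p, closure Omega p ->
       A p = - pderiv e2 Z p /\ B p = pderiv e1 Z p)
    (f : R * R -> R[i])
    (f_L1 : Lq Omega 1 f) :
  {ae leb2, forall p, Omega p -> cintegrable Omega (TZ_kernel Z f p)} /\
  forall q : R, 1 <= q -> q < 2 - sigma / (sigma + 1) ->
    Lq Omega q (TZ Omega Z f).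
Proof.
have [V [oV KV [eps e0 [hu hv]]]] := Z_C1eps.
have hu' : C1eps V (fun p => complex.Re (Z p)) by exists eps.
have hv' : C1eps V (fun p => complex.Im (Z p)) by exists eps.
have cu p : V p -> {for p, continuous (fun p => complex.Re (Z p))}.
  exact: C1eps_continuous.
have cv p : V p -> {for p, continuous (fun p => complex.Im (Z p))}.
  exact: C1eps_continuous.
have OmV p : Omega p -> V p by move=> Op; apply: KV; exact: subset_closure.
have injZ p q : Omega p -> Omega q -> Z p = Z q -> p = q.
  have [G [_ GK _]] := Z_homeo; move=> Op Oq e.
  by rewrite -(GK p (subset_closure Op)) -(GK q (subset_closure Oq)) e.
have sp := small_preimages_closure Omega_open Sigma_def Sigma_nontangent
  Sigma_components sigma_gt0 Sigma_exponent oV KV hu' hv' injZ L_eq.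
rewrite -sigma_max in sp.
have [C C0 hC] := small_preimages_uniform oV Omega_open Omega_relcompact KV cu cv sp.
have mOm := open_measurable2 Omega_open.
have Omoo := leb2_lty mOm Omega_relcompact.
have s0 : 0 <= sigma by rewrite sigma_max; exact: bigmax_ge_id.
have main q : 1 <= q -> q < 2 - sigma / (sigma + 1) ->
  {ae leb2, forall p, Omega p -> cintegrable Omega (TZ_kernel Z f p)} /\
  Lq Omega q (TZ Omega Z f).
  move=> q1 qtau.
  have [C' C'0 hC'] := kernel_integral_le Omega_open (fun p Op => cu p (OmV p Op))
    (fun p Op => cv p (OmV p Op)) Omoo C0 q1 qtau hC.
  have mre := open_continuous_measurable2 Omega_open (fun p Op => cu p (OmV p Op)).
  have mim := open_continuous_measurable2 Omega_open (fun p Op => cv p (OmV p Op)).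
  split; first exact: (ae_cintegrable_TZ_kernel mOm mre mim f_L1 q1 C'0 hC').
  exact: (TZ_Lq mOm Omoo mre mim f_L1 q1 C'0 hC').
(* Since [1 < 2 - sigma / (sigma + 1)], the exponent [q = 1] is admissible; it
   gives the convergence of the integral for almost every [p]. *)
split; last by move=> q q1 qtau; exact: (main q q1 qtau).2.
suff tau1 : 1 < 2 - sigma / (sigma + 1) by exact: (main 1 (lexx 1) tau1).1.
rewrite ltrBrDr addrC -ltrBrDr ltr_pdivrMr ?ltr_wpDl//.
by rewrite (_ : 2 - 1 = 1 :> R) ?mul1r ?ltrDl//; ring.
Qed.
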